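(* Let $1<p<\infty$, $1\le q<\infty$, $p\ne q$, and let $\{A_n\}_{n\ge1}$ be the (infinitely many) atoms of a purely atomic measure space, $0<\mu(A_n)<\infty$. Then $\ell_{p,q}(\{A_n\})$ is isomorphic to a space of one of the following types: $$\ell_{p,q,1},\quad \ell_{p,q,\infty},\quad \ell_{p,q,0}(F),\quad \ell_{p,q,0}(I),\quad \ell_{p,q,0}(F)\oplus\ell_{p,q,1},\quad \ell_{p,q,0}(F)\oplus\ell_{p,q,\infty},$$ where a space of type $A\oplus B$ means a direct sum of a space of type $A$ and a space of type $B$.
   Context: For a $\sigma$-finite measure space $(\Omega,\Sigma,\mu)$, $1<p<\infty$ and $1\le q<\infty$, $L_{p,q}(\Omega)$ is the space of (classes of) real measurable functions $f$ with $\|f\|_{p,q}=\left(\int_0^\infty f^*(t)^q\,d(t^{q/p})\right)^{1/q}<\infty$, where $f^*(t)=\inf\{s>0:\mu(\{|f|>s\})\le t\}$. If $q\le p$ this is a norm; if $q>p$ it is a complete quasi-norm equivalent to a complete norm. If $\Omega$ consists of atoms $A_n$, $n\ge1$ (infinitely many), with $0<\mu(A_n)<\infty$, the space $L_{p,q}(\Omega)$ is denoted $\ell_{p,q}(\{A_n\})$. It is said to be: of type $\ell_{p,q,0}(F)$ if $\mu(A_n)\to0$ and $\sum_n\mu(A_n)<\infty$; of type $\ell_{p,q,0}(I)$ if $\mu(A_n)\to0$ and $\sum_n\mu(A_n)=\infty$; of type $\ell_{p,q,\infty}$ if $\mu(A_n)\to\infty$; of type $\ell_{p,q,1}$ if $0<\liminf_n\mu(A_n)\le\limsup_n\mu(A_n)<\infty$.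 Isomorphic means linearly homeomorphic. *)

(* Defs.v *)
From HB Require Import structures.
From mathcomp Require Import all_boot all_order all_algebra.
From mathcomp Require Import all_classical all_reals all_analysis measurable_realfun.
From mathcomp Require Import ring lra.
Set Implicit Arguments. Unset Strict Implicit. Unset Printing Implicit Defensive.
Import Order.TTheory GRing.Theory Num.Theory.
Import numFieldNormedType.Exports.
Local Open Scope classical_set_scope.
Local Open Scope ring_scope.

Section power_cumulative.
Context {R : realType} (r : R) (r0 : 0 < r).

(* The truncation at 0 matters because [powR] is 1, not 0, on negative reals. *)
Definition powR_pos (_ : 0 < r) (t : R) : R := (Num.max 0 t) `^ r.

Let powR_pos_nondecreasing : nondecreasing (powR_pos r0).
Proof.
move=> x y xy; rewrite /powR_pos; apply: ge0_ler_powR; first exact: ltW.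
- by rewrite nnegrE le_max lexx.
- by rewrite nnegrE le_max lexx.
- by rewrite ge_max !le_max lexx/= xy orbT.
Qed.

Let powR_pos_right_continuous : right_continuous (powR_pos r0).
Proof.
move=> x; have [x0|x0] := ltP x 0.
  apply: cvg_near_cst.
  near=> y; rewrite /powR_pos !max_l//; first exact: ltW.
  have : y < 0 by near: y; exact: nbhs_right_lt.
  exact: ltW.
rewrite /powR_pos (max_r x0).
have H : t `^ r @[t --> x^'+] --> x `^ r.
  move: x0; rewrite le_eqVlt => /predU1P[<-|x0].
    by rewrite powR0 ?gt_eqF//; exact: powR_cvg0.
  apply: cvg_at_right_filter.
  have := @is_derive1_powR R r x x0.
  by move=> /@ex_derive /derivable1_diffP /differentiable_continuous.
apply: cvg_trans H; apply: near_eq_cvg.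
near=> y; rewrite max_r//.
have : x < y by near: y; exact: nbhs_right_gt.
by move=> xy; rewrite ltW// (le_lt_trans x0).
Unshelve. all: by end_near. Qed.

HB.instance Definition _ := isCumulative.Build R _ R (powR_pos r0)
  powR_pos_nondecreasing powR_pos_right_continuous.

End power_cumulative.

Section rearrangement.
Context d (T : measurableType d) (R : realType) (mu : {measure set T -> \bar R}).

Definition rearrangement (f : T -> R) (t : R) : \bar R :=
  ereal_inf [set s%:E | s in
    [set s : R | 0 < s /\ (mu [set x | (s < `|f x|)%R] <= t%:E)%E]].

Lemma rearrangement_ge0 f t : (0 <= rearrangement f t)%E.
Proof. by apply: le_ereal_inf_tmp => _ [s [s0 _] <-]; rewrite lee_fin ltW. Qed.

Lemma rearrangement_nonincreasing f s t :
  s <= t -> (rearrangement f t <= rearrangement f s)%E.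
Proof.
move=> st; apply: ereal_inf_le_tmp => _ [u [u0 mufu] <-]; exists u => //.
by split=> //; rewrite (le_trans mufu)// lee_fin.
Qed.

Lemma measurable_rearrangement f (D : set R) :
  measurable D -> measurable_fun D (rearrangement f).
Proof.
move=> mD; apply: (measurable_funS measurableT) => //.
apply: (measurability _ (ErealGenOInfty.measurableE R)).
move=> _ [_ [y ->] <-]; rewrite setTI.
suff : is_interval (rearrangement f @^-1` `]y%:E, +oo[).
  exact: is_interval_measurable.
move=> a b; rewrite /= !in_itv/= !andbT => ya yb c /andP[ac cb].
by rewrite in_itv/= andbT (lt_le_trans yb)// rearrangement_nonincreasing.
Qed.

Let measurable_dist (f : {mfun T >-> R}) (s : R) :
  measurable [set x | s < `|f x|].
Proof.
rewrite (_ : [set _ | _] = (Num.norm \o f) @^-1` `]s, +oo[).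
  by rewrite -[X in measurable X]setTI; apply: measurableT_comp.
by apply/seteqP; split => x /=; rewrite in_itv/= andbT.
Qed.

Lemma rearrangement_ae_eq (f g : {mfun T >-> R}) :
  (f : T -> R) = g %[ae mu] -> rearrangement f = rearrangement g.
Proof.
move=> [N [mN N0 fgN]]; apply/funext => t.
suff E s : mu [set x | (s < `|f x|)%R] = mu [set x | (s < `|g x|)%R].
  rewrite /rearrangement; congr ereal_inf; apply/seteqP.
  by split=> _ [s [s0 ms] <-]; exists s => //; split; rewrite // ?E// -E.
have fg x : ~ N x -> f x = g x.
  by move=> Nx; apply: contrapT => fgx; apply: Nx; apply: fgN => /(_ I).
rewrite -(measureU0 (measurable_dist f s) mN N0).
rewrite -(measureU0 (measurable_dist g s) mN N0); congr (mu _).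
by apply/seteqP; split => x /=; have [Nx|Nx] := pselect (N x);
  [right|move=> [|//]; rewrite fg//; left|right|move=> [|//]; rewrite fg//; left].
Qed.

Lemma rearrangementD (f g : {mfun T >-> R}) (t : R) :
  (rearrangement (f \+ g)%R t <=
   rearrangement f (t / 2) + rearrangement g (t / 2))%E.
Proof.
rewrite leNgt; apply/negP.
set a := rearrangement f _; set b := rearrangement g _ => abfg.
have a0 : (0 <= a)%E := rearrangement_ge0 _ _.
have b0 : (0 <= b)%E := rearrangement_ge0 _ _.
have : (a + b < +oo)%E by exact: (lt_le_trans abfg (leey _)).
move: abfg; rewrite /a/b; case Ea : (rearrangement f _) => [u| |] //; last first.
- by move: a0; rewrite /a Ea.
- by rewrite addye ?ltxx// gt_eqF// (lt_le_trans _ b0).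
case Eb : (rearrangement g _) => [v| |] //; last first.
  by move: b0; rewrite /b Eb.
move=> abfg _.
have [w [uvw wfg]] : exists w, u + v < w /\ (w%:E <= rearrangement (f \+ g)%R t)%E.
  move: abfg; case: (rearrangement _ _) => [z| |]//=.
    by move=> uvz; exists z; split; [rewrite -lte_fin|].
  by move=> _; exists (u + v + 1); split; [rewrite ltrDl|rewrite leey].
pose e := (w - u - v) / 4%:R.
have e0 : 0 < e by rewrite /e; lra.
have [_ [s1 [s10 mus1] <-]] : exists2 y, [set s%:E | s in
    [set s : R | 0 < s /\ (mu [set x | (s < `|f x|)%R] <= (t / 2)%:E)%E]] y
    & (y < (u + e)%:E)%E.
  by apply: ereal_inf_lt; rewrite -/(rearrangement _ _) Ea lte_fin ltrDl.
rewrite lte_fin => s1u.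
have [_ [s2 [s20 mus2] <-]] : exists2 y, [set s%:E | s in
    [set s : R | 0 < s /\ (mu [set x | (s < `|g x|)%R] <= (t / 2)%:E)%E]] y
    & (y < (v + e)%:E)%E.
  by apply: ereal_inf_lt; rewrite -/(rearrangement _ _) Eb lte_fin ltrDl.
rewrite lte_fin => s2v.
have : (rearrangement (f \+ g)%R t <= (s1 + s2)%:E)%E.
  apply: ereal_inf_lbound; exists (s1 + s2) => //; split; first exact: addr_gt0.
  rewrite (splitr t) EFinD; apply: (le_trans _ (leeD mus1 mus2)).
  apply: le_trans (measureU2 _ _ _) => //.
  apply: le_measure; rewrite ?inE.
  - exact: (measurable_dist (f \+ g)).
  - by apply: measurableU.
  - move=> x /= s12; rewrite /setU/=.
    have [s1f|fs1] := ltP s1 `|f x|; [by left|right].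
    rewrite ltNge; apply/negP => gs2.
    have := le_lt_trans (lerD fs1 gs2) (lt_le_trans s12 (ler_normD _ _)).
    by rewrite ltxx.
move=> /(le_trans wfg); rewrite lee_fin => ws.
have : w < (u + e) + (v + e) by rewrite (le_lt_trans ws)// ltrD.
rewrite /e; lra.
Qed.

End rearrangement.
Section lorentz_norm.
Context {R : realType} (p q : R) (hp : 1 < p) (hq : 1 <= q).

Lemma exponent_ratio_gt0 : 0 < q / p.
Proof. by rewrite divr_gt0// ?(lt_trans ltr01 hp) ?(lt_le_trans ltr01 hq). Qed.

(* The measure d(t^(q/p)) on [0, +oo[. *)
Definition lorentz_measure :=
  lebesgue_stieltjes_measure (powR_pos exponent_ratio_gt0).

HB.instance Definition _ := Measure.on lorentz_measure.

Context d (T : measurableType d) (mu : {measure set T -> \bar R}).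

Definition lorentz_norm (f : T -> R) : \bar R :=
  ((\int[lorentz_measure]_(t in `[0%R, +oo[)
      (rearrangement mu f t `^ q)) `^ q^-1)%E.

Definition finite_lorentz_norm (f : T -> R) := (lorentz_norm f < +oo)%E.

Let q_gt0 : 0 < q. Proof. exact: lt_le_trans hq. Qed.

Lemma finite_lorentz_normE f : finite_lorentz_norm f =
  (\int[lorentz_measure]_(t in `[0%R, +oo[)
      (rearrangement mu f t `^ q) < +oo)%E.
Proof.
apply/idP/idP; first by apply: lty_poweRy; rewrite invr_eq0 gt_eqF.
exact: poweR_lty.
Qed.

Let measurable_rearrangementX f (D : set R) :
  measurable D -> measurable_fun D (fun t => rearrangement mu f t `^ q)%E.
Proof.
move=> mD; apply: (@measurableT_comp _ _ _ _ _ _ (@poweR R ^~ q)).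
  exact: measurable_poweR.
exact: measurable_rearrangement.
Qed.

Let half (t : measurableTypeR R) : measurableTypeR R := t / 2.

Let measurable_half : measurable_fun setT half.
Proof. exact: measurable_funM. Qed.

Lemma lorentz_measure_half (A : set R) : measurable A ->
  (lorentz_measure A =
   (2 `^ (q / p))^-1%:E * pushforward lorentz_measure half A)%E.
Proof.
have c0 : (0 : R) <= (2 `^ (q / p))^-1 by rewrite invr_ge0 powR_ge0.
move=> mA; pose nu : {measure set (measurableTypeR R) -> \bar R} :=
  measure_function_pushforward__canonical__measure_function_Measure
    lorentz_measure measurable_half.
rewrite -[RHS]/(mscale (NngNum c0) nu A).
have U := @lebesgue_stieltjes_measure_unique R (powR_pos exponent_ratio_gt0) (mscale (NngNum c0) nu).
apply: U => //= _ [[a b]/= _ <-].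
rewrite /mscale/= /nu /pushforward.
rewrite (_ : half @^-1` _ = `]a * 2, b * 2]%classic); last first.
  by apply/seteqP; split => x /=; rewrite !in_itv/= /half ltr_pdivlMr// ler_pdivrMr.
rewrite /lorentz_measure /lebesgue_stieltjes_measure /measure_extension/=.
rewrite !measurable_mu_extE/=; [|exact: is_ocitv..].
have [ab | ba] := leP a b; last first.
  by rewrite !set_itv_ge ?wlength0 ?mule0// bnd_simp -leNgt ltW// ltr_pM2r.
rewrite !wlength_itv_bnd ?ler_pM2r// -EFinM; congr EFin.
have M x : powR_pos exponent_ratio_gt0 (x * 2) = 2 `^ (q / p) * powR_pos exponent_ratio_gt0 x.
  rewrite /powR_pos -powRM ?ler0n// ?le_max ?lexx//.
  by rewrite maxr_pMr ?ler0n// mulr0 mulrC.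
by rewrite !M -mulrBr mulrA mulVf ?mul1r// gt_eqF// powR_gt0.
Qed.

Lemma lorentz_measure_integral_half (h : R -> \bar R) :
  (forall t, 0 <= h t)%E -> measurable_fun setT h ->
  (\int[lorentz_measure]_(t in `[0%R, +oo[) h t < +oo)%E ->
  (\int[lorentz_measure]_(t in `[0%R, +oo[) h (t / 2)%R < +oo)%E.
Proof.
move=> h0 mh; pose nu : {measure set (measurableTypeR R) -> \bar R} :=
  measure_function_pushforward__canonical__measure_function_Measure
    lorentz_measure measurable_half.
have c0 : (0 : R) < (2 `^ (q / p))^-1 by rewrite invr_gt0 powR_gt0.
rewrite (eq_measure_integral (mscale (NngNum (ltW c0)) nu)); last first.
  by move=> A mA _; exact: lorentz_measure_half.
rewrite ge0_integral_mscale//; last exact: measurable_funS mh.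
rewrite ge0_integral_pushforward//; last exact: measurable_funS mh.
rewrite (_ : half @^-1` _ = `[0, +oo[%classic); last first.
  by apply/seteqP; split => x /=; rewrite !in_itv/= /half !andbT pmulr_lge0 ?invr_gt0.
rewrite /= -[X in (_ -> X < _)%E]/(\int[lorentz_measure]_(t in `[0%R, +oo[) (h \o half) t)%E.
have : (0 <= \int[lorentz_measure]_(t in `[0%R, +oo[) (h \o half) t)%E.
  by apply: integral_ge0 => t _; exact: h0.
set I := integral _ _ _; case: I => [r _ _|_|//]; first exact: ltry.
by rewrite gt0_muley// lte_fin.
Qed.

Lemma finite_lorentz_normD (f g : {mfun T >-> R}) :
  finite_lorentz_norm f -> finite_lorentz_norm g ->
  finite_lorentz_norm (f \+ g).
Proof.
rewrite !finite_lorentz_normE.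
have X0 (k : T -> R) t : (0 <= rearrangement mu k t `^ q)%E by exact: poweR_ge0.
move=> /(lorentz_measure_integral_half (X0 f) (measurable_rearrangementX f measurableT)) Hf.
move=> /(lorentz_measure_integral_half (X0 g) (measurable_rearrangementX g measurableT)) Hg.
have mX (k : T -> R) :
    measurable_fun setT (fun t : R => rearrangement mu k (t / 2)%R `^ q)%E.
  exact: (measurableT_comp (measurable_rearrangementX k measurableT) measurable_half).
have mXD (k : T -> R) : measurable_fun (`[0%R, +oo[%classic : set R)
    (fun t : R => rearrangement mu k (t / 2)%R `^ q)%E.
  exact: measurable_funS (mX k).
apply: (@le_lt_trans _ _ (\int[lorentz_measure]_(t in `[0%R, +oo[)
    ((2 `^ q)%:E * (rearrangement mu f (t / 2)%R `^ q +
     rearrangement mu g (t / 2)%R `^ q)))%E).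
  apply: ge0_le_integral => //.
  - exact: measurable_rearrangementX.
  - by apply: measurable_funeM; apply: emeasurable_funD; exact: mXD.
  move=> t _; have := rearrangementD mu f g t.
  set a := rearrangement mu f _; set b := rearrangement mu g _ => abfg.
  have a0 : (0 <= a)%E := rearrangement_ge0 _ _ _.
  have b0 : (0 <= b)%E := rearrangement_ge0 _ _ _.
  have c0 : (0 <= rearrangement mu (f \+ g)%R t)%E := rearrangement_ge0 _ _ _.
  have pw (x y : \bar R) : (0 <= x -> x <= y -> x `^ q <= y `^ q)%E.
    move=> x0 xy; apply: gt0_ler_poweR => //; first exact: ltW.
      by rewrite in_itv/= x0 leey.
    by rewrite in_itv/= leey (le_trans x0).
  wlog ab : a b a0 b0 abfg / (a <= b)%E.
    move=> W; have [|/ltW] := leP a b; first exact: W.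
    by rewrite [X in (_ * X)%E]addeC; apply: W => //; rewrite addeC.
  apply: (@le_trans _ _ ((2%R%:E * b) `^ q)%E).
    apply: pw => //; apply: (le_trans abfg).
    rewrite -[2%R]/(1 + 1)%R EFinD ge0_muleDl ?lee01// mul1e.
    exact: leeD.
  rewrite poweRM// poweR_EFin lee_wpmul2l ?lee_fin ?powR_ge0//.
  by rewrite leeDr ?poweR_ge0.
rewrite ge0_integralZl//; last 2 first.
- by apply: emeasurable_funD; exact: mXD.
- by move=> t _; exact: adde_ge0.
rewrite ge0_integralD//; [|exact: mXD..].
by rewrite lte_mul_pinfty ?lee_fin ?powR_ge0// lte_add_pinfty.
Qed.

Lemma rearrangementZ (a : R) (f : T -> R) t : a != 0 ->
  rearrangement mu (a \*: f) t = (`|a|%:E * rearrangement mu f t)%E.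
Proof.
move=> a0; have na0 : 0 < `|a| by rewrite normr_gt0.
rewrite -ereal_inf_pZl//; congr ereal_inf; apply/seteqP; split => x /=.
- move=> [s [s0 ms] <-]; exists (`|a|^-1 * s)%:E; last first.
    by rewrite -EFinM mulrA mulfV ?mul1r// gt_eqF.
  exists (`|a|^-1 * s) => //; split; first by rewrite mulr_gt0// invr_gt0.
  rewrite (_ : [set _ | _] = [set x | (s < `|(a \*: f) x|)%R])//.
  by apply/seteqP; split => y /=; rewrite normrM ltr_pdivrMl.
- move=> [_ [s [s0 ms] <-] <-]; exists (`|a| * s); last by rewrite EFinM.
  split; first exact: mulr_gt0.
  rewrite (_ : [set _ | _] = [set x | (s < `|f x|)%R])//.
  by apply/seteqP; split => y /=; rewrite normrM ltr_pM2l.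
Qed.

Lemma finite_lorentz_norm0 : finite_lorentz_norm (cst 0).
Proof.
rewrite finite_lorentz_normE (_ : integral _ _ _ = 0%E) ?ltry//.
apply: integral0_eq => t; rewrite /= in_itv/= andbT => t0.
suff -> : rearrangement mu (cst 0) t = 0%E by rewrite poweR0r// gt_eqF.
apply/eqP; rewrite eq_le rearrangement_ge0 andbT.
apply/lee_addgt0Pr => e e0; rewrite add0e.
apply: ereal_inf_lbound; exists e => //; split => //.
rewrite (_ : [set _ | _] = set0) ?measure0//.
by apply/seteqP; split => x //=; rewrite normr0 ltNge (ltW e0).
Qed.

Lemma finite_lorentz_normZ (a : R) (f : {mfun T >-> R}) :
  finite_lorentz_norm f -> finite_lorentz_norm (a \*: f).
Proof.
have [->|a0] := eqVneq a 0.
  move=> _; rewrite (_ : 0 \*: _ = cst 0); first exact: finite_lorentz_norm0.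
  by apply/funext => x /=; rewrite scale0r.
rewrite !finite_lorentz_normE => fF.
under eq_integral do rewrite rearrangementZ// poweRM ?rearrangement_ge0// poweR_EFin.
rewrite ge0_integralZl//.
- by rewrite lte_mul_pinfty ?lee_fin ?powR_ge0.
- exact: measurable_rearrangementX.
- by move=> t _; exact: poweR_ge0.
Qed.

End lorentz_norm.

Section lorentz_space.
Context {R : realType} (p q : R) (hp : 1 < p) (hq : 1 <= q).
Context d (T : measurableType d) (mu : {measure set T -> \bar R}).

Definition in_lorentz : {pred {mfun T >-> R}} :=
  [pred f : {mfun T >-> R} | finite_lorentz_norm hp hq mu f].

Let in_lorentz_submod_closed : submod_closed in_lorentz.
Proof.
split; first exact: finite_lorentz_norm0.
move=> a f g fL gL; apply: (@finite_lorentz_normD _ _ _ hp hq _ _ mu (a *: f)) gL.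
exact: finite_lorentz_normZ.
Qed.

HB.instance Definition _ := GRing.isSubmodClosed.Build R {mfun T >-> R}
  in_lorentz in_lorentz_submod_closed.

Definition lorentz_fun : Type := {f : {mfun T >-> R} | f \in in_lorentz}.
HB.instance Definition _ := SubChoice.on lorentz_fun.
HB.instance Definition _ := [SubChoice_isSubLmodule of lorentz_fun by <:].

Definition lorentz_ae_eq (f g : lorentz_fun) : bool :=
  `[< (\val f : T -> R) = (\val g : T -> R) %[ae mu] >].

Let lorentz_ae_eq_refl : reflexive lorentz_ae_eq.
Proof. by move=> f; exact/asboolP/ae_eq_refl. Qed.

Let lorentz_ae_eq_sym : symmetric lorentz_ae_eq.
Proof. by move=> f g; apply/asboolP/asboolP => /ae_eq_sym. Qed.

Let lorentz_ae_eq_trans : transitive lorentz_ae_eq.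
Proof.
by move=> g f h /asboolP fg /asboolP gh; exact/asboolP/(ae_eq_trans fg gh).
Qed.

Canonical lorentz_ae_eq_equiv := EquivRel lorentz_ae_eq
  lorentz_ae_eq_refl lorentz_ae_eq_sym lorentz_ae_eq_trans.

Local Open Scope quotient_scope.

Definition lorentz_space : Type := {eq_quot lorentz_ae_eq}.
HB.instance Definition _ := Choice.on lorentz_space.
HB.instance Definition _ := EqQuotient.on lorentz_space.

Definition lorentz_class (f : lorentz_fun) : lorentz_space :=
  \pi_lorentz_space f.

Lemma lorentz_classP (f g : lorentz_fun) :
  lorentz_class f = lorentz_class g <->
  (\val f : T -> R) = (\val g : T -> R) %[ae mu].
Proof.
split => [/eqP|fg]; first by rewrite /lorentz_class eqmodE => /asboolP.
by apply/eqP; rewrite /lorentz_class eqmodE; exact/asboolP.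
Qed.

Lemma lorentz_class_repr (x : lorentz_space) : lorentz_class (repr x) = x.
Proof. exact: reprK. Qed.

Lemma repr_lorentz_class (f : lorentz_fun) :
  (\val (repr (lorentz_class f)) : T -> R) = (\val f : T -> R) %[ae mu].
Proof. by apply/lorentz_classP; exact: lorentz_class_repr. Qed.

Definition lorentz_zero : lorentz_space := lorentz_class 0.
Definition lorentz_opp (x : lorentz_space) := lorentz_class (- repr x).
Definition lorentz_add (x y : lorentz_space) := lorentz_class (repr x + repr y).
Definition lorentz_scale (a : R) (x : lorentz_space) :=
  lorentz_class (a *: repr x).

Lemma lorentz_class_add (f g : lorentz_fun) :
  lorentz_add (lorentz_class f) (lorentz_class g) = lorentz_class (f + g).
Proof.
apply/lorentz_classP; rewrite !raddfD/=.
apply: filterS2 (repr_lorentz_class f) (repr_lorentz_class g) => x ff gg _ /=.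
exact: (f_equal2 +%R (ff I) (gg I)).
Qed.

Lemma lorentz_class_opp (f : lorentz_fun) :
  lorentz_opp (lorentz_class f) = lorentz_class (- f).
Proof.
apply/lorentz_classP; rewrite !raddfN/=.
apply: filterS (repr_lorentz_class f) => x ff _ /=.
exact: (f_equal -%R (ff I)).
Qed.

Lemma lorentz_class_scale a (f : lorentz_fun) :
  lorentz_scale a (lorentz_class f) = lorentz_class (a *: f).
Proof.
apply/lorentz_classP; rewrite !linearZ/=.
apply: filterS (repr_lorentz_class f) => x ff _ /=.
exact: (f_equal ( *%R a) (ff I)).
Qed.

Let addA : associative lorentz_add.
Proof.
move=> x y z; rewrite -[x]lorentz_class_repr -[y]lorentz_class_repr.
by rewrite -[z]lorentz_class_repr !lorentz_class_add addrA.
Qed.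

Let addC : commutative lorentz_add.
Proof. by move=> x y; rewrite /lorentz_add addrC. Qed.

Let add0 : left_id lorentz_zero lorentz_add.
Proof.
by move=> x; rewrite -[x]lorentz_class_repr lorentz_class_add add0r.
Qed.

Let addN : left_inverse lorentz_zero lorentz_opp lorentz_add.
Proof.
move=> x; rewrite -[x]lorentz_class_repr lorentz_class_opp lorentz_class_add.
by rewrite addNr.
Qed.

HB.instance Definition _ := GRing.isZmodule.Build lorentz_space
  addA addC add0 addN.

Let scaleA a b (x : lorentz_space) :
  lorentz_scale a (lorentz_scale b x) = lorentz_scale (a * b) x.
Proof.
by rewrite -[x]lorentz_class_repr !lorentz_class_scale scalerA.
Qed.

Let scale1 : left_id 1 lorentz_scale.
Proof. by move=> x; rewrite /lorentz_scale scale1r lorentz_class_repr. Qed.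

Let scaleDr : right_distributive lorentz_scale +%R.
Proof.
move=> a x y; rewrite -[x]lorentz_class_repr -[y]lorentz_class_repr.
by rewrite [_ + _]lorentz_class_add !lorentz_class_scale
  [RHS]lorentz_class_add scalerDr.
Qed.

Let scaleDl (x : lorentz_space) :
  {morph lorentz_scale^~ x : a b / a + b}.
Proof.
move=> a b; rewrite -[x]lorentz_class_repr !lorentz_class_scale.
by rewrite [RHS]lorentz_class_add scalerDl.
Qed.

HB.instance Definition _ := GRing.Zmodule_isLmodule.Build R lorentz_space
  scaleA scale1 scaleDr scaleDl.

Definition lorentz_qnorm (x : lorentz_space) : \bar R :=
  lorentz_norm hp hq mu (\val (repr x)).

Lemma lorentz_qnorm_class (f : lorentz_fun) :
  lorentz_qnorm (lorentz_class f) = lorentz_norm hp hq mu (\val f).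
Proof.
rewrite /lorentz_qnorm /lorentz_norm.
by rewrite (rearrangement_ae_eq (repr_lorentz_class f)).
Qed.

(* The neighbourhoods of [x] are the supersets of the balls of [lorentz_qnorm]
   around [x]; for q > p such a ball need not itself be open. *)

Definition lorentz_open (U : set lorentz_space) : Prop :=
  forall x, U x -> exists2 e : R, 0 < e &
    forall y, (lorentz_qnorm (y - x)%R < e%:E)%E -> U y.

Let lorentz_openT : lorentz_open setT.
Proof. by move=> x _; exists 1. Qed.

Let lorentz_openI : setI_closed lorentz_open.
Proof.
move=> U V oU oV x [/oU[e e0 eU] /oV[e' e'0 eV]].
exists (Num.min e e'); first by rewrite lt_min e0.
move=> y; rewrite EFin_min lt_min => /andP[ye ye'].
by split; [exact: eU|exact: eV].
Qed.

Let lorentz_open_bigU (I : Type) (f : I -> set lorentz_space) :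
  (forall i, lorentz_open (f i)) -> lorentz_open (\bigcup_i f i).
Proof.
move=> of_ x [i _ /of_[e e0 ef]].
by exists e => // y /ef fy; exists i.
Qed.

HB.instance Definition _ := isOpenTopological.Build lorentz_space
  lorentz_openT lorentz_openI lorentz_open_bigU.

End lorentz_space.

Section isomorphism.
Context {R : realType}.

HB.instance Definition _ (V W : preTopologicalLmodType R) :=
  Topological.on (V * W)%type.

Definition isomorphic (V W : preTopologicalLmodType R) : Prop :=
  exists (f : {linear V -> W}) (g : W -> V),
    [/\ cancel f g, cancel g f, continuous f & continuous g].

End isomorphism.

Section atoms.
Context d (T : measurableType d) (R : realType) (mu : {measure set T -> \bar R}).

Definition atom (A : set T) : Prop :=
  [/\ measurable A, (0 < mu A)%E &
      forall B, measurable B -> B `<=` A -> mu B = 0%E \/ mu (A `\` B) = 0%E].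

(* Atoms are only determined up to null sets, so the [A n] are disjoint
   representatives that need only exhaust the space up to a null set. *)
Definition purely_atomic (A : nat -> set T) : Prop :=
  [/\ forall n, atom (A n), forall n, (mu (A n) < +oo)%E, trivIset setT A &
      mu.-negligible (~` \bigcup_n A n)].

End atoms.

Section types.
Context {R : realType}.

(* Below, [u n] is the measure of the n-th atom. *)
Definition type_one (u : nat -> \bar R) : Prop :=
  [/\ (0 < limn_einf u)%E, (limn_einf u <= limn_esup u)%E &
      (limn_esup u < +oo)%E].

Definition type_infty (u : nat -> \bar R) : Prop := u @ \oo --> +oo%E.

Definition type_zeroF (u : nat -> \bar R) : Prop :=
  u @ \oo --> 0%E /\ (\sum_(0 <= n <oo) u n < +oo)%E.

Definition type_zeroI (u : nat -> \bar R) : Prop :=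
  u @ \oo --> 0%E /\ (\sum_(0 <= n <oo) u n = +oo)%E.

Context (p q : R) (hp : 1 < p) (hq : 1 <= q).

Definition iso_to_type (P : (nat -> \bar R) -> Prop)
    (V : preTopologicalLmodType R) : Prop :=
  exists d (T : measurableType d) (mu : {measure set T -> \bar R})
    (A : nat -> set T),
  [/\ purely_atomic mu A, P (mu \o A) & isomorphic V (lorentz_space hp hq mu)].

(* The direct sum is the product module with the product topology. *)
Definition iso_to_sum (P Q : (nat -> \bar R) -> Prop)
    (V : preTopologicalLmodType R) : Prop :=
  exists d1 (T1 : measurableType d1) (mu1 : {measure set T1 -> \bar R})
    (A1 : nat -> set T1)
    d2 (T2 : measurableType d2) (mu2 : {measure set T2 -> \bar R})
    (A2 : nat -> set T2),
  [/\ purely_atomic mu1 A1 /\ P (mu1 \o A1),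
      purely_atomic mu2 A2 /\ Q (mu2 \o A2) &
      isomorphic V (lorentz_space hp hq mu1 * lorentz_space hp hq mu2)%type].

End types.

(* Main.v *)
From HB Require Import structures.
Require Import Defs.
From mathcomp Require Import all_boot all_order all_algebra.
From mathcomp Require Import all_classical all_reals all_analysis measurable_realfun.
From mathcomp Require Import ring lra zify.
Set Implicit Arguments. Unset Strict Implicit. Unset Printing Implicit Defensive.
Import Order.TTheory GRing.Theory Num.Theory.
Import numFieldNormedType.Exports.
Local Open Scope classical_set_scope.
Local Open Scope ring_scope.

(** Let the n-th atom have size a_n. A measurable function is almost everywhere
    constant on each atom (atom_ae_constant), so the Lorentz space is a space of
    sequences whose quasi-norm depends only on the sums of the a_n over the sets
    {s < |x_n|} (coordinates_lorentz). It is therefore enough to find bounded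
    linear isomorphisms, called seq_iso below, between such sequence spaces, and
    the space on the other side can be chosen freely (iso_to_typeP,
    iso_to_sumP).

    Two operations relate these spaces. Relabelling the atoms
    and changing their sizes by bounded factors is an isomorphism. And disjoint
    finite blocks of atoms can be treated as single bigger atoms: the step
    sequences on the blocks form a subspace, onto which averaging is a projection
    that is bounded because 1 < p (bounded_op_avg).

    These combine into an absorption principle. Let U be a space with infinitely
    many atoms of every size from a countable family. If the atoms of a of size at
    most w have infinite total size for every w in the family, then blocks of atoms
    of a imitate all the atoms of U, so U is a complemented subspace of the space of
    a. As U is isomorphic to its square, the space of a is isomorphic to its sum
    with U (seq_iso_retract). If moreover each a_n is comparable to a size in the
    family, then U absorbs the atoms of a one by one (seq_iso_absorb), and
    the space of a is isomorphic to U (seq_iso_universal).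

    The classification follows. If for every v > 0 the atoms of size at most v have
    infinite total size, the space is isomorphic to the one with sizes 1 / (n + 1),
    of type l_{p,q,0}(I), because both are universal for the union of the two
    families of sizes (seq_iso_harmonic). Otherwise the atoms of size at most some
    v > 0 have finite total size. If infinite in number they form a space of type
    l_{p,q,0}(F). The remaining atoms, if infinite in number, are bounded below:
    either their sizes tend to infinity, or infinitely many lie below some M and
    the absorption principle identifies the space with the one in which all sizes
    are M (large_sizes). If one of the two parts is finite, all the sizes together
    are summable, or all of them are bounded below. *)

(** * Decreasing rearrangements and the Lorentz energy *)

Section dilation.
Context {R : realType} (p q : R) (hp : 1 < p) (hq : 1 <= q) (c : R) (c0 : 0 < c).
Local Notation lam := (lorentz_measure hp hq).

Let scale (t : measurableTypeR R) : measurableTypeR R := t / c.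

Let measurable_scale : measurable_fun setT scale.
Proof. exact: measurable_funM. Qed.

Let lorentz_measure_scale (A : set R) : measurable A ->
  (lam A = (c `^ (q / p))^-1%:E * pushforward lam scale A)%E.
Proof.
have r0 : (0 : R) <= (c `^ (q / p))^-1 by rewrite invr_ge0 powR_ge0.
move=> mA; pose nu : {measure set (measurableTypeR R) -> \bar R} :=
  measure_function_pushforward__canonical__measure_function_Measure
    lam measurable_scale.
rewrite -[RHS]/(mscale (NngNum r0) nu A).
have U := @lebesgue_stieltjes_measure_unique R
  (powR_pos (exponent_ratio_gt0 hp hq)) (mscale (NngNum r0) nu).
apply: U => //= _ [[a b]/= _ <-].
rewrite /mscale/= /nu /pushforward.
rewrite (_ : scale @^-1` _ = `]a * c, b * c]%classic); last first.
  by apply/seteqP; split => x /=;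
    rewrite !in_itv/= /scale ltr_pdivlMr// ler_pdivrMr.
rewrite /lorentz_measure /lebesgue_stieltjes_measure /measure_extension/=.
rewrite !measurable_mu_extE/=; [|exact: is_ocitv..].
have [ab|ba] := leP a b; last first.
  by rewrite !set_itv_ge ?wlength0 ?mule0// bnd_simp -leNgt ltW// ltr_pM2r.
rewrite !wlength_itv_bnd ?ler_pM2r// -EFinM; congr EFin.
have M x : powR_pos (exponent_ratio_gt0 hp hq) (x * c) =
    c `^ (q / p) * powR_pos (exponent_ratio_gt0 hp hq) x.
  rewrite /powR_pos -powRM ?(ltW c0)// ?le_max ?lexx//.
  by rewrite maxr_pMr ?(ltW c0)// mulr0 mulrC.
by rewrite !M -mulrBr mulrA mulVf ?mul1r// gt_eqF// powR_gt0.
Qed.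

(** The measure d(t^(q/p)) is homogeneous of degree q/p, so stretching time by c
    multiplies integrals by c^(q/p). Every bound below is obtained by comparing
    a rearrangement with dilates of another one. *)
Lemma lorentz_integral_dilation (h : R -> \bar R) :
  (forall t, 0 <= h t)%E -> measurable_fun setT h ->
  (\int[lam]_(t in `[0%R, +oo[) h (t / c)%R =
   (c `^ (q / p))%:E * \int[lam]_(t in `[0%R, +oo[) h t)%E.
Proof.
move=> h0 mh; pose nu : {measure set (measurableTypeR R) -> \bar R} :=
  measure_function_pushforward__canonical__measure_function_Measure
    lam measurable_scale.
have r0 : (0 : R) < (c `^ (q / p))^-1 by rewrite invr_gt0 powR_gt0.
rewrite [in RHS](eq_measure_integral (mscale (NngNum (ltW r0)) nu)); last first.
  by move=> A mA _; exact: lorentz_measure_scale.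
rewrite ge0_integral_mscale//; last exact: measurable_funS mh.
rewrite ge0_integral_pushforward//; last exact: measurable_funS mh.
rewrite (_ : scale @^-1` _ = `[0, +oo[%classic); last first.
  by apply/seteqP; split => x /=;
    rewrite !in_itv/= /scale !andbT pmulr_lge0 ?invr_gt0.
rewrite /= muleA -EFinM mulfV ?mul1e//.
by rewrite gt_eqF// powR_gt0.
Qed.

End dilation.

Section energy.
Context {R : realType} (p q : R) (hp : 1 < p) (hq : 1 <= q).
Local Notation lam := (lorentz_measure hp hq).
Implicit Types D E : R -> \bar R.

Let q_gt0 : 0 < q. Proof. exact: lt_le_trans hq. Qed.

(** Only the distribution function D s = mu {s < |f|} of f enters its
    rearrangement, so D is the primitive datum and no measure space is needed. *)
Definition rearr D (t : R) : \bar R :=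
  ereal_inf [set s%:E | s in [set s : R | 0 < s /\ (D s <= t%:E)%E]].

(** This is the q-th power of the Lorentz quasi-norm. Without the root, sums and
    dilations act on it through plain constants. *)
Definition energy D : \bar R :=
  (\int[lam]_(t in `[0%R, +oo[) (rearr D t `^ q))%E.

Lemma rearr_ge0 D t : (0 <= rearr D t)%E.
Proof. by apply: le_ereal_inf_tmp => _ [s [s0 _] <-]; rewrite lee_fin ltW. Qed.

Lemma rearr_le D t s : 0 < s -> (D s <= t%:E)%E -> (rearr D t <= s%:E)%E.
Proof. by move=> s0 Ds; apply: ereal_inf_lbound; exists s. Qed.

Lemma le_rearr D t (z : \bar R) :
  (forall s, 0 < s -> (D s <= t%:E)%E -> (z <= s%:E)%E) -> (z <= rearr D t)%E.
Proof. by move=> H; apply: le_ereal_inf_tmp => _ [s [s0 Ds] <-]; exact: H. Qed.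

Lemma rearr_nonincreasing D s t : s <= t -> (rearr D t <= rearr D s)%E.
Proof.
move=> st; apply: le_rearr => u u0 Du; apply: rearr_le => //.
by rewrite (le_trans Du)// lee_fin.
Qed.

Lemma rearr_lt D t s : {homo D : u v / u <= v >-> (v <= u)%E} ->
  (rearr D t < s%:E)%E -> (D s <= t%:E)%E.
Proof.
move=> D_noninc /ereal_inf_lt[_ [u [u0 Du] <-]]; rewrite lte_fin => us.
by apply: (le_trans _ Du); apply: D_noninc; exact: ltW.
Qed.

Lemma measurable_rearr D (B : set R) : measurable B -> measurable_fun B (rearr D).
Proof.
move=> mB; apply: (measurable_funS measurableT) => //.
apply: (measurability _ (ErealGenOInfty.measurableE R)).
move=> _ [_ [y ->] <-]; rewrite setTI.
suff : is_interval (rearr D @^-1` `]y%:E, +oo[) by exact: is_interval_measurable.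
move=> a b; rewrite /= !in_itv/= !andbT => ya yb c /andP[ac cb].
by rewrite in_itv/= andbT (lt_le_trans yb)// rearr_nonincreasing.
Qed.

Lemma measurable_rearrX D (B : set R) :
  measurable B -> measurable_fun B (fun t => rearr D t `^ q)%E.
Proof.
move=> mB; apply: (@measurableT_comp _ _ _ _ _ _ (@poweR R ^~ q)).
  exact: measurable_poweR.
exact: measurable_rearr.
Qed.

Lemma measurable_rearr_scale D (c : R) (B : set R) : measurable B ->
  measurable_fun B (fun t : R => rearr D (t * c)%R `^ q)%E.
Proof.
move=> mB; apply: (measurable_funS measurableT) => //.
have mc : measurable_fun (setT : set (measurableTypeR R))
    (fun t : R => t * c : measurableTypeR R) by exact: measurable_funM.
exact: (measurableT_comp (measurable_rearrX D measurableT) mc).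
Qed.

Lemma energy_ge0 D : (0 <= energy D)%E.
Proof. by apply: integral_ge0 => t _; exact: poweR_ge0. Qed.

Lemma poweR_le (x y : \bar R) : (0 <= x -> x <= y -> x `^ q <= y `^ q)%E.
Proof.
move=> x0 xy; apply: gt0_ler_poweR => //; first exact: ltW.
  by rewrite in_itv/= x0 leey.
by rewrite in_itv/= leey (le_trans x0).
Qed.

Lemma energy_dilation D (c : R) : 0 < c ->
  (\int[lam]_(t in `[0%R, +oo[) (rearr D (t / c)%R `^ q) =
   (c `^ (q / p))%:E * energy D)%E.
Proof.
move=> c0; exact: (lorentz_integral_dilation hp hq c0 (fun t => poweR_ge0 (rearr D t) q)
  (measurable_rearrX D measurableT)).
Qed.

(** If D <= c E then the rearrangement of D at t is at most that of E at t / c,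
    and the dilation rule applies. *)
Lemma energy_le D E (c : R) : 0 < c -> (forall s : R, (0 < s)%R -> D s <= c%:E * E s)%E ->
  (energy D <= (c `^ (q / p))%:E * energy E)%E.
Proof.
have X0 F u : (0 <= rearr F u `^ q)%E by exact: poweR_ge0.
move=> c0 DE; rewrite -energy_dilation//; apply: ge0_le_integral => //.
- exact: measurable_rearrX.
- exact: measurable_rearr_scale.
move=> t _; apply: poweR_le; first exact: rearr_ge0.
apply: le_rearr => s s0 Es; apply: rearr_le => //.
apply: (le_trans (DE _ s0)); rewrite muleC -lee_pdivlMr//.
Qed.

Lemma le_of_lt_EFin (z w : \bar R) : (0 <= w)%E ->
  (forall s : R, 0 < s -> (w < s%:E)%E -> (z <= s%:E)%E) -> (z <= w)%E.
Proof.
case: w => [w| |] //; last by move=> _ _; rewrite leey.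
rewrite lee_fin => w0 H; apply/lee_addgt0Pr => e e0.
by rewrite -EFinD; apply: H; rewrite ?lte_fin ?ltrDl// ltr_wpDl.
Qed.

(** The quasi-triangle inequality: at time t the rearrangement of a sum is at
    most twice the larger of the two rearrangements at time t / 2. *)
Lemma energyD D D1 D2 :
  {homo D1 : u v / u <= v >-> (v <= u)%E} ->
  {homo D2 : u v / u <= v >-> (v <= u)%E} ->
  (forall s, 0 < s -> (D (2 * s)%R <= D1 s + D2 s)%E) ->
  (energy D <= (2 `^ q * 2 `^ (q / p))%:E * (energy D1 + energy D2))%E.
Proof.
have X0 F u : (0 <= rearr F u `^ q)%E by exact: poweR_ge0.
move=> D1n D2n DD; rewrite EFinM -muleA ge0_muleDr ?energy_ge0//.
rewrite -!energy_dilation//.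
rewrite -ge0_integralD//; [|exact: measurable_rearr_scale..].
rewrite -ge0_integralZl//; last 2 first.
- by apply: emeasurable_funD; exact: measurable_rearr_scale.
- by move=> t _; exact: adde_ge0.
apply: ge0_le_integral => //.
- exact: measurable_rearrX.
- by apply: measurable_funeM; apply: emeasurable_funD; exact: measurable_rearr_scale.
move=> t _; set a := rearr D1 _; set b := rearr D2 _.
have a0 : (0 <= a)%E := rearr_ge0 _ _.
have b0 : (0 <= b)%E := rearr_ge0 _ _.
have Dab : (rearr D t <= 2%:E * maxe a b)%E.
  rewrite -lee_pdivrMl//; apply: le_of_lt_EFin; first by rewrite le_max a0.
  move=> s s0; rewrite gt_max => /andP[as_ bs].
  rewrite lee_pdivrMl// -EFinM; apply: rearr_le; first exact: mulr_gt0.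
  rewrite (le_trans (DD _ s0))// [in leRHS](splitr t) EFinD.
  by apply: leeD; exact: rearr_lt.
apply: (le_trans (poweR_le (rearr_ge0 _ _) Dab)).
rewrite poweRM// ?le_max ?a0// poweR_EFin lee_wpmul2l ?lee_fin ?powR_ge0//.
by have [_|_] := leP a b; rewrite ?leeDl ?leeDr ?poweR_ge0.
Qed.

End energy.

(** * Weighted sequence spaces and bounded operators *)

Section esum_extra.
Context {R : realType}.

Lemma esum_pZl (I : choiceType) (c : R) (f : I -> \bar R) : 0 < c ->
  (forall i, 0 <= f i)%E ->
  (\esum_(i in setT) (c%:E * f i) = c%:E * \esum_(i in setT) f i)%E.
Proof.
move=> c0 f0; rewrite /esum -ereal_sup_pZl//; congr ereal_sup.
rewrite [in RHS]image_comp; apply: eq_imagel => A _ /=.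
by rewrite ge0_mule_fsumr.
Qed.

Lemma esumZl (I : choiceType) (c : R) (f : I -> \bar R) : 0 <= c ->
  (forall i, 0 <= f i)%E ->
  (\esum_(i in setT) (c%:E * f i) = c%:E * \esum_(i in setT) f i)%E.
Proof.
rewrite le_eqVlt => /predU1P[<- _|]; last exact: esum_pZl.
by rewrite mul0e esum1// => i _; rewrite mul0e.
Qed.

Lemma esum_geometric (c r : R) : 0 <= c -> 0 <= r -> r < 1 ->
  (\esum_(l in [set: nat]) (c * r ^+ l)%:E = (c / (1 - r))%:E)%E.
Proof.
move=> c0 r0 r1; rewrite -nneseries_esumT; last first.
  by move=> l; rewrite lee_fin mulr_ge0// exprn_ge0.
apply/cvg_lim => //.
rewrite (_ : (fun n => _) = EFin \o series (geometric c r)); last first.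
  by apply/funext => n /=; rewrite sumEFin.
by apply: cvg_EFin; [exact: nearW|apply: cvg_geometric_series; rewrite ger0_norm].
Qed.

(** Bernoulli: r^n >= 1 + n (r - 1). *)
Lemma expr_unbounded (r x : R) : 1 < r -> exists n, x <= r ^+ n.
Proof.
move=> r1; have r10 : 0 < r - 1 by rewrite subr_gt0.
have B n : 1 + (r - 1) * n%:R <= r ^+ n.
  elim: n => [|n IH]; first by rewrite expr0 mulr0 addr0.
  rewrite exprS -natr1; have n0 : 0 <= n%:R :> R by [].
  have := ler_wpM2l (ltW (lt_trans ltr01 r1)) IH.
  by have := mulr_ge0 (sqr_ge0 (r - 1)) n0; lra.
exists (Num.bound (`|x| / (r - 1))); apply: le_trans (B _).
have /archi_boundP : 0 <= `|x| / (r - 1) by rewrite divr_ge0// ltW.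
rewrite ltr_pdivrMr// mulrC => /ltW H.
by rewrite (le_trans (ler_norm x))// (le_trans H)// lerDr.
Qed.

Lemma esum_sumtype (I J : choiceType) (f : I + J -> \bar R) :
  (forall k, 0 <= f k)%E ->
  (\esum_(k in setT) f k =
   \esum_(i in setT) f (inl i) + \esum_(j in setT) f (inr j))%E.
Proof.
move=> f0; rewrite (esumID (range inl))// !setTI.
rewrite (_ : ~` range inl = range inr); last first.
  apply/seteqP; split=> [[i|j] //= H|_ [j _ <-] [i _ //]].
  - by exfalso; apply: H; exists i.
  - by exists j.
by rewrite !esum_image// => ? ? _ _ [].
Qed.

Lemma exchange_esum (I J : choiceType) (f : I -> J -> \bar R) :
  (forall i j, 0 <= f i j)%E ->
  (\esum_(i in setT) \esum_(j in setT) f i j =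
   \esum_(j in setT) \esum_(i in setT) f i j)%E.
Proof.
move=> f0; rewrite !esum_esum//.
rewrite (@reindex_esum _ _ _ (setT `*`` (fun=> setT)) _ (fun k : J * I => (k.2, k.1)))//.
split=> [[j i]//|[j i] [j' i'] _ _ [-> ->]//|[i j] _]; by exists (j, i).
Qed.

Lemma le_esum_inj (I J : choiceType) (e : J -> I) (f : I -> \bar R) :
  injective e -> (forall i, 0 <= f i)%E ->
  (\esum_(j in setT) f (e j) <= \esum_(i in setT) f i)%E.
Proof.
move=> einj f0; rewrite -(@esum_image R J I setT e f); last by move=> ? ? _ _ /einj.
rewrite [leRHS](esumID (range e))// setTI leeDl//.
by apply: esum_ge0.
Qed.

Lemma esum_ge1 (I : choiceType) (f : I -> \bar R) i :
  (forall i, 0 <= f i)%E -> (f i <= \esum_(i in setT) f i)%E.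
Proof.
move=> f0; rewrite (esumID [set i])// setTI esum_set1// leeDl//.
exact: esum_ge0.
Qed.

Lemma esum_seq (I : choiceType) (r : seq I) (f : I -> \bar R) :
  uniq r -> (forall i, 0 <= f i)%E ->
  (\esum_(i in [set` r]) f i = \sum_(i <- r) f i)%E.
Proof. by move=> ur f0; rewrite esum_fset// [RHS]fsbig_seq. Qed.

End esum_extra.

Section weighted.
Context {R : realType} (p q : R) (hp : 1 < p) (hq : 1 <= q).
Implicit Types (I J K : choiceType).

Definition wdistr I (a : I -> {posnum R}) (x : I -> R) (s : R) : \bar R :=
  \esum_(i in setT) (if s < `|x i| then (a i)%:num else 0)%:E.

Definition wenergy I (a : I -> {posnum R}) (x : I -> R) : \bar R :=
  energy hp hq (wdistr a x).

Let term_ge0 I (a : I -> {posnum R}) (x : I -> R) (s : R) i :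
  (0 <= (if s < `|x i| then (a i)%:num else 0)%:E)%E.
Proof. by rewrite lee_fin; case: ifP. Qed.

Lemma wdistr_nonincreasing I (a : I -> {posnum R}) x :
  {homo wdistr a x : u v / u <= v >-> (v <= u)%E}.
Proof.
move=> u v uv; apply: le_esum => i _; rewrite lee_fin.
case: ifPn => [vx|_]; last by case: ifP.
by rewrite (le_lt_trans uv vx).
Qed.

Lemma wdistrN I (a : I -> {posnum R}) x : wdistr a (fun i => - x i) = wdistr a x.
Proof. by apply/funext => s; apply: eq_esum => i _; rewrite normrN. Qed.

Lemma wdistrD I (a : I -> {posnum R}) x y s :
  (wdistr a (fun i => x i + y i)%R (2 * s)%R <= wdistr a x s + wdistr a y s)%E.
Proof.
rewrite /wdistr -esumD//; apply: le_esum => i _; rewrite -EFinD lee_fin.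
case: ifPn => [sxy|_]; last by rewrite addr_ge0//; case: ifP.
have [sx|xs] := ltP s `|x i|; first by rewrite lerDl; case: ifP.
rewrite add0r ifT// ltNge; apply/negP => ys.
by have := lt_le_trans sxy (ler_normD _ _); lra.
Qed.

Definition wsum I J (a : I -> {posnum R}) (b : J -> {posnum R}) (k : I + J) :=
  match k with inl i => a i | inr j => b j end.

Lemma wdistr_sum I J (a : I -> {posnum R}) (b : J -> {posnum R}) x s :
  wdistr (wsum a b) x s =
  (wdistr a (fun i => x (inl i)) s + wdistr b (fun j => x (inr j)) s)%E.
Proof.
by rewrite /wdistr esum_sumtype// => k; rewrite lee_fin; case: ifP.
Qed.

Lemma wenergy_ge0 I (a : I -> {posnum R}) x : (0 <= wenergy a x)%E.
Proof. exact: energy_ge0. Qed.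

Definition quasi_cst : R := 2 `^ q * 2 `^ (q / p).

Lemma quasi_cst_gt0 : 0 < quasi_cst.
Proof. by rewrite mulr_gt0// powR_gt0. Qed.

(** One of |x_i|, |y_i| exceeds s as soon as |x_i + y_i| exceeds 2 s, so the
    quasi-triangle inequality applies to distribution functions. *)
Lemma wenergyD I (a : I -> {posnum R}) x y :
  (wenergy a (fun i => x i + y i)%R <= quasi_cst%:E * (wenergy a x + wenergy a y))%E.
Proof.
apply: energyD; [exact: wdistr_nonincreasing..|move=> s _; exact: wdistrD].
Qed.

Lemma wenergy_sum I J (a : I -> {posnum R}) (b : J -> {posnum R}) x :
  (wenergy (wsum a b) x <=
  quasi_cst%:E * (wenergy a (fun i => x (inl i)) + wenergy b (fun j => x (inr j))))%E.
Proof.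
apply: energyD; [exact: wdistr_nonincreasing..|move=> s s0].
rewrite -wdistr_sum; apply: wdistr_nonincreasing.
by rewrite ler_pMl// ler1n.
Qed.

Definition linear_op I J (F : (I -> R) -> (J -> R)) :=
  forall k x y, F (fun i => k * x i + y i) = (fun j => k * F x j + F y j).

(** A bounded linear operator between the spaces of finite energy that is
    defined on all sequences; all the operators of the proof have this form, so
    finiteness of the energy never has to be carried along. *)
Definition bounded_op I J (a : I -> {posnum R}) (b : J -> {posnum R})
    (F : (I -> R) -> (J -> R)) : Prop :=
  linear_op F /\ exists2 C : R, 0 < C & forall x, (wenergy b (F x) <= C%:E * wenergy a x)%E.

Lemma bounded_op_of_wdistr I J (a : I -> {posnum R}) (b : J -> {posnum R}) F (c : R) :
  linear_op F -> 0 < c ->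
  (forall x s, 0 < s -> (wdistr b (F x) s <= c%:E * wdistr a x s)%E) ->
  bounded_op a b F.
Proof.
move=> linF c0 H; split=> //; exists (c `^ (q / p)); first exact: powR_gt0.
by move=> x; apply: energy_le => // s s0; exact: H.
Qed.

Lemma bounded_op_id I (a : I -> {posnum R}) : bounded_op a a id.
Proof. by split=> //; exists 1 => // x; rewrite mul1e. Qed.

Lemma bounded_op_comp I J K (a : I -> {posnum R}) (b : J -> {posnum R})
    (c : K -> {posnum R}) F G : bounded_op a b F -> bounded_op b c G -> bounded_op a c (G \o F).
Proof.
move=> [linF [C C0 FC]] [linG [C' C'0 GC]]; split.
  by move=> k x y /=; rewrite linF linG.
exists (C' * C); first exact: mulr_gt0.
move=> x; apply: le_trans (GC _) _; rewrite EFinM -muleA.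
by rewrite lee_wpmul2l// lee_fin ltW.
Qed.

Lemma bounded_opD I J (a : I -> {posnum R}) (b : J -> {posnum R}) F G :
  bounded_op a b F -> bounded_op a b G -> bounded_op a b (fun x j => F x j + G x j).
Proof.
move=> [linF [C C0 FC]] [linG [C' C'0 GC]]; split.
  by move=> k x y; apply/funext => j; rewrite linF linG; ring.
exists (quasi_cst * (C + C')).
  by rewrite mulr_gt0 ?quasi_cst_gt0// addr_gt0.
move=> x; apply: le_trans (wenergyD _ _ _) _; rewrite (EFinM quasi_cst) -muleA.
rewrite lee_wpmul2l// ?lee_fin ?(ltW quasi_cst_gt0)// EFinD.
by rewrite ge0_muleDl ?lee_fin ?(ltW C0) ?(ltW C'0)//; exact: leeD.
Qed.

Lemma bounded_opN I J (a : I -> {posnum R}) (b : J -> {posnum R}) F :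
  bounded_op a b F -> bounded_op a b (fun x j => - F x j).
Proof.
move=> [linF [C C0 FC]]; split.
  by move=> k x y; apply/funext => j; rewrite linF; ring.
exists C; first exact: C0.
by move=> x; have := FC x; rewrite /wenergy (wdistrN b (F x)).
Qed.

Lemma bounded_op_pair I J K (a : I -> {posnum R}) (b : J -> {posnum R})
    (c : K -> {posnum R}) F G : bounded_op a b F -> bounded_op a c G ->
  bounded_op a (wsum b c)
    (fun x k => match k with inl j => F x j | inr l => G x l end).
Proof.
move=> [linF [C C0 FC]] [linG [C' C'0 GC]]; split.
  by move=> k x y; apply/funext => -[j|l]; rewrite ?linF ?linG.
exists (quasi_cst * (C + C')).
  by rewrite mulr_gt0 ?quasi_cst_gt0// addr_gt0.
move=> x; apply: le_trans (wenergy_sum _ _ _) _; rewrite (EFinM quasi_cst) -muleA.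
rewrite lee_wpmul2l// ?lee_fin ?(ltW quasi_cst_gt0)// EFinD.
by rewrite ge0_muleDl ?lee_fin ?(ltW C0) ?(ltW C'0)//; exact: leeD.
Qed.

(** An injective relabelling cannot increase the distribution function by more
    than the ratio of the sizes. This covers restrictions to subsets of the
    atoms as well as bijections. *)
Lemma bounded_op_relabel I J (a : I -> {posnum R}) (b : J -> {posnum R})
    (e : J -> I) (c : R) : injective e -> 0 < c ->
  (forall j, (b j)%:num <= c * (a (e j))%:num) ->
  bounded_op a b (fun x j => x (e j)).
Proof.
move=> einj c0 bc; apply: (bounded_op_of_wdistr _ c0) => // x s s0.
rewrite -esum_pZl//; apply: le_trans (le_esum_inj einj _); last first.
  by move=> i; rewrite mule_ge0// lee_fin ltW.
apply: le_esum => j _; rewrite -EFinM lee_fin.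
by case: ifP => _; rewrite ?mulr0.
Qed.

End weighted.

(** * Step sequences and averages over blocks of atoms *)

Section blocks.
Context {R : realType} (p q : R) (hp : 1 < p) (hq : 1 <= q).
Context (I J : choiceType) (a : I -> {posnum R}) (b : J -> {posnum R}).
Context (blk : J -> seq I) (idx : I -> option J).
Hypothesis blk_uniq : forall j, uniq (blk j).
Hypothesis blkE : forall i j, (i \in blk j) = (idx i == Some j).

(** A block blk j plays the part of one bigger atom, of size mass j; idx i is
    the index of the block containing i, if any. *)
Definition mass (j : J) : R := \sum_(i <- blk j) (a i)%:num.
Definition step (y : J -> R) (i : I) : R := oapp y 0 (idx i).
Definition avg (x : I -> R) (j : J) : R :=
  (\sum_(i <- blk j) (a i)%:num * x i) / mass j.

Lemma esum_blocks (f : I -> \bar R) : (forall i, 0 <= f i)%E ->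
  (\esum_(j in setT) \sum_(i <- blk j) f i =
   \esum_(i in setT) if idx i is Some _ then f i else 0)%E.
Proof.
move=> f0; under eq_esum do rewrite -esum_seq// esum_mkcond.
rewrite exchange_esum; last by move=> j i; case: ifP.
apply: eq_esum => i _; under eq_esum do rewrite mem_setE blkE.
case: (idx i) => [j|]; last by apply: esum1.
transitivity (\esum_(j' in [set j]) f i)%E; last by rewrite esum_set1.
rewrite [RHS]esum_mkcond; apply: eq_esum => j' _.
rewrite (inj_eq Some_inj); have [->|jj'] := eqVneq j j'; first by rewrite mem_set.
by rewrite memNset//= => j'j; rewrite j'j eqxx in jj'.
Qed.

Lemma linear_step : linear_op step.
Proof.
move=> k x y; apply/funext => i; rewrite /step.
by case: (idx i) => //=; rewrite mulr0 addr0.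
Qed.

Lemma linear_avg : linear_op avg.
Proof.
move=> k x y; apply/funext => j; rewrite /avg mulrA -mulrDl; congr (_ / _).
by rewrite big_distrr -big_split/=; apply: eq_bigr => i _; ring.
Qed.

Lemma wdistr_step y s : 0 < s -> wdistr a (step y) s =
  (\esum_(j in setT) (if s < `|y j| then mass j else 0)%:E)%E.
Proof.
move=> s0; pose f i : \bar R := (if s < `|step y i| then (a i)%:num else 0)%:E.
have f0 i : (0 <= f i)%E by rewrite lee_fin; case: ifP.
transitivity (\esum_(i in setT) if idx i is Some _ then f i else 0)%E.
  apply: eq_esum => i _; rewrite /f /step; case: (idx i) => //=.
  by rewrite normr0 ltNge (ltW s0).
rewrite -esum_blocks//; apply: eq_esum => j _.
rewrite (eq_big_seq (fun i => (if s < `|y j| then (a i)%:num else 0)%:E)).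
  rewrite sumEFin; case: ifP => _//.
  by rewrite big1.
by move=> i; rewrite blkE => /eqP ij; rewrite /f /step ij.
Qed.

(** A step sequence exceeds s exactly on the union of the blocks on which y does. *)
Lemma bounded_op_step (c : R) : 0 < c -> (forall j, mass j <= c * (b j)%:num) ->
  bounded_op hp hq b a step.
Proof.
move=> c0 mb; apply: (bounded_op_of_wdistr hp hq linear_step c0) => x s s0.
rewrite wdistr_step// -esum_pZl//; last first.
  by move=> j; rewrite lee_fin; case: ifP.
apply: le_esum => j _; rewrite -EFinM lee_fin.
by case: ifP => _; rewrite ?mulr0.
Qed.

Lemma avg_step y : (forall j, blk j != [::]) -> avg (step y) = y.
Proof.
move=> blk0; apply/funext => j; rewrite /avg.
rewrite (eq_big_seq (fun i => (a i)%:num * y j)); last first.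
  by move=> i; rewrite blkE => /eqP ij; rewrite /step ij.
rewrite -big_distrl/= -/(mass j) mulrAC mulfV ?mul1r// gt_eqF//.
rewrite /mass; have := blk0 j; case: (blk j) => // i r _.
by rewrite big_cons ltr_pwDl// sumr_ge0.
Qed.

Context (rho : R) (rho1 : 1 < rho) (rho2 : rho < 2).

Definition avg_cst : R := rho / (1 - rho / 2).

Let rho0 : 0 < rho. Proof. exact: lt_trans rho1. Qed.

Lemma avg_cst_gt0 : 0 < avg_cst.
Proof. by rewrite divr_gt0// subr_gt0 ltr_pdivrMr ?mul1r. Qed.

(** The slices k rho^l < |x_i| <= k rho^(l+1) have total size at most t / 2^l,
    so the sum of |x_i| over k < |x_i| is dominated by the geometric series
    of ratio rho / 2. This is a weak-type substitute for the l^1 norm of the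
    part of x above k. *)
Lemma tail_sum_le x (t k : R) : 0 < k ->
  (forall l : nat, wdistr a x (k * rho ^+ l)%R <= (t / 2 ^+ l)%R%:E)%E ->
  (\esum_(i in setT) (if k < `|x i| then (a i)%:num * `|x i| else 0)%:E <=
   (k * t * avg_cst)%:E)%E.
Proof.
move=> k0 H.
have t0 : 0 <= t.
  rewrite -lee_fin; have := H 0%N; rewrite expr0 divr1; apply: le_trans.
  by apply: esum_ge0 => i _; rewrite lee_fin; case: ifP.
have kr l : 0 < k * rho ^+ l by rewrite mulr_gt0// exprn_gt0.
pose g (i : I) (l : nat) : \bar R := ((k * rho ^+ l.+1)%:E *
   (if k * rho ^+ l < `|x i| then (a i)%:num else 0)%:E)%E.
have i0 i l : (0 <= (if k * rho ^+ l < `|x i| then (a i)%:num else 0)%:E)%E.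
  by rewrite lee_fin; case: ifP.
have g0 i l : (0 <= g i l)%E by rewrite mule_ge0// lee_fin ltW.
apply: (@le_trans _ _ (\esum_(i in setT) \esum_(l in setT) g i l)%E).
  apply: le_esum => i _; case: ifPn => [kx|_]; last exact: esum_ge0.
  have [n xn] := expr_unbounded (`|x i| / k) rho1.
  have ex : exists n, `|x i| <= k * rho ^+ n.
    by exists n; rewrite mulrC -ler_pdivrMr.
  case: (ex_minnP ex) => -[|m]; first by rewrite expr0 mulr1 leNgt kx.
  move=> xm min_m; have mx : k * rho ^+ m < `|x i|.
    by rewrite ltNge; apply/negP => /min_m; rewrite ltnn.
  (* m is the last level below |x_i|, so this single term already dominates. *)
  apply: (le_trans _ (esum_ge1 m (g0 i))).
  by rewrite /g mx -EFinM lee_fin mulrC ler_wpM2r.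
rewrite exchange_esum//.
apply: (@le_trans _ _ (\esum_(l in setT) ((k * t * rho) * (rho / 2) ^+ l)%:E)%E).
  apply: le_esum => l _; rewrite esumZl//; last exact: ltW (kr _).
  apply: (@le_trans _ _ ((k * rho ^+ l.+1)%:E * (t / 2 ^+ l)%:E)%E).
    by rewrite lee_wpmul2l// ?lee_fin ?(ltW (kr _))//; exact: H.
  rewrite -EFinM lee_fin exprS expr_div_n le_eqVlt; apply/orP; left; apply/eqP.
  by ring.
rewrite esum_geometric//.
- by rewrite /avg_cst mulrA.
- by rewrite !mulr_ge0// ltW.
- by rewrite divr_ge0// ltW.
- by rewrite ltr_pdivrMr ?mul1r.
Qed.

(** Split x at height k. The average of the lower part is at most k, and by
    Markov's inequality the average of the upper part exceeds avg_cst * k only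
    on blocks of total size at most t, because its l^1 norm is at most
    avg_cst * k * t by tail_sum_le. *)
Lemma wdistr_avg_le x (t k : R) : 0 < k -> (forall j, (b j)%:num <= mass j) ->
  (forall l : nat, wdistr a x (k * rho ^+ l)%R <= (t / 2 ^+ l)%R%:E)%E ->
  (wdistr b (avg x) ((1 + avg_cst) * k)%R <= t%:E)%E.
Proof.
move=> k0 bm H.
pose g i : R := if k < `|x i| then (a i)%:num * `|x i| else 0.
have g0 i : (0 <= (g i)%:E)%E.
  by rewrite lee_fin /g; case: ifP => // _; rewrite mulr_ge0.
have ck : 0 < avg_cst * k by rewrite mulr_gt0// avg_cst_gt0.
have Hg : ((avg_cst * k)%:E * wdistr b (avg x) ((1 + avg_cst) * k)%R <=
    \esum_(i in setT) (g i)%:E)%E.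
  apply: (@le_trans _ _ (\esum_(j in setT) \sum_(i <- blk j) (g i)%:E)%E); last first.
    rewrite esum_blocks//; apply: le_esum => i _.
    by case: (idx i).
  rewrite -esum_pZl//; last by move=> j; rewrite lee_fin; case: ifP.
  apply: le_esum => j _; rewrite sumEFin -EFinM lee_fin.
  case: ifPn => [xj|_]; last first.
    by rewrite mulr0 sumr_ge0// => i _; rewrite -lee_fin.
  have m0 : 0 < mass j by exact: lt_le_trans (bm j).
  have S : `|\sum_(i <- blk j) (a i)%:num * x i| <= k * mass j + \sum_(i <- blk j) g i.
    rewrite (le_trans (ler_norm_sum _ _ _))// /mass big_distrr/= -big_split/=.
    apply: ler_sum => i _; rewrite normrM ger0_norm//.
    rewrite /g; case: (ltP k `|x i|) => [_|xk]; first by rewrite lerDr mulr_ge0 ?(ltW k0).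
    by rewrite addr0 mulrC ler_wpM2r.
  move: xj; rewrite /avg normrM normfV (gtr0_norm m0) ltr_pdivlMr// => xj.
  have : avg_cst * k * mass j <= \sum_(i <- blk j) g i by nra.
  by apply: le_trans; rewrite ler_wpM2l// ltW.
have := le_trans Hg (tail_sum_le k0 H).
by rewrite -lee_pdivlMl// -EFinM => /le_trans; apply; rewrite lee_fin
  (_ : k * t * avg_cst = (avg_cst * k) * t) ?mulKf ?gt_eqF//; ring.
Qed.

End blocks.

(** * Boundedness of averaging *)

Section averaging.
Context {R : realType} (p q : R) (hp : 1 < p) (hq : 1 <= q).
Local Notation lam := (lorentz_measure hp hq).

Let q_gt0 : 0 < q. Proof. exact: lt_le_trans hq. Qed.

Lemma poweR_le_real (y : \bar R) (k : R) : 0 <= k -> (0 <= y)%E ->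
  (y `^ q <= (k `^ q)%:E)%E -> (y <= k%:E)%E.
Proof.
move=> k0; case: y => [y| |]//.
  rewrite lee_fin poweR_EFin !lee_fin => y0; apply: contraLR; rewrite -!ltNge.
  by move=> ky; apply: gt0_ltr_powR; rewrite ?nnegrE.
by rewrite poweRyr ?gt_eqF// leye_eq.
Qed.

Lemma powRX (x r : R) n : 0 <= x -> (x ^+ n) `^ r = (x `^ r) ^+ n.
Proof.
move=> x0; elim: n => [|n IH]; first by rewrite !expr0 powR1.
by rewrite !exprS powRM ?exprn_ge0// IH.
Qed.

(** The hypothesis says that a bound D (k rho^l) <= t / 2^l at all scales l gives
    E (c k) <= t. If K^q is the sum over l of rho^(-lq) times the q-th power of
    the rearrangement of D at t / 2^l, then every k > K satisfies such bounds,
    so the rearrangement of E at t is at most c K. Integrating the q-th powers,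
    the dilation rule turns the sum into the geometric series of ratio
    (2^(1/p) / rho)^q. *)
Lemma energy_of_scales (D E : R -> \bar R) (rho c : R) :
  2 `^ p^-1 < rho -> 0 < c -> {homo D : u v / u <= v >-> (v <= u)%E} ->
  (forall t k, 0 < k -> (forall l : nat, (D (k * rho ^+ l)%R <= (t / 2 ^+ l)%R%:E)%E) ->
     (E (c * k)%R <= t%:E)%E) ->
  (energy hp hq E <=
    (c `^ q / (1 - 2 `^ (q / p) / rho `^ q))%:E * energy hp hq D)%E.
Proof.
move=> hrho c0 Dn H.
have rho0 : 0 < rho by apply: le_lt_trans hrho; exact: powR_ge0.
have rl l : 0 < rho ^+ l by exact: exprn_gt0.
pose w l : R := ((rho ^+ l) `^ q)^-1.
have w0 l : 0 < w l by rewrite invr_gt0 powR_gt0.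
pose S t : \bar R := (\sum_(l <oo) (w l)%:E * rearr D (t / 2 ^+ l)%R `^ q)%E.
have X0 F u : (0 <= rearr F u `^ q)%E by exact: poweR_ge0.
have wX0 l F u : (0 <= (w l)%:E * rearr F u `^ q)%E by rewrite mule_ge0// lee_fin ltW.
have S0 t : (0 <= S t)%E by apply: nneseries_ge0 => l _ _.
have ES t : (rearr E t `^ q <= (c `^ q)%:E * S t)%E.
  have := S0 t; case SE : (S t) => [s| |]// s0; last first.
    by rewrite gt0_muley ?leey// lte_fin powR_gt0.
  rewrite lee_fin in s0; pose K := s `^ q^-1.
  have K0 : 0 <= K by exact: powR_ge0.
  have Kq : K `^ q = s by rewrite -powRrM mulVf ?powRr1// gt_eqF.
  have DK l : (rearr D (t / 2 ^+ l)%R <= (K * rho ^+ l)%R%:E)%E.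
    apply: poweR_le_real; rewrite ?rearr_ge0 ?mulr_ge0 ?(ltW (rl l))//.
    rewrite powRM ?(ltW (rl l))// Kq EFinM -lee_pdivrMr ?lte_fin ?powR_gt0// muleC.
    rewrite -/(w l) -SE /S nneseries_esumT; last by move=> i; exact: wX0.
    exact: (esum_ge1 l (fun i => wX0 i D _)).
  rewrite -Kq -EFinM -powRM ?(ltW c0)// -poweR_EFin.
  apply: poweR_le => //; first exact: rearr_ge0.
  apply: le_of_lt_EFin; first by rewrite lee_fin mulr_ge0// ltW.
  move=> s' s'0; rewrite lte_fin mulrC -ltr_pdivlMr// => Ks'.
  have k0 : 0 < s' / c by rewrite divr_gt0.
  apply: rearr_le => //.
  have {1}-> : s' = c * (s' / c) by rewrite mulrCA mulfV ?mulr1// gt_eqF.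
  apply: H => // l; apply: rearr_lt => //; apply: le_lt_trans (DK l) _.
  by rewrite lte_fin ltr_pM2r.
have theta0 : 0 <= 2 `^ (q / p) / rho `^ q by rewrite divr_ge0 ?powR_ge0.
have theta1 : 2 `^ (q / p) / rho `^ q < 1.
  rewrite ltr_pdivrMr ?powR_gt0// mul1r mulrC powRrM.
  by apply: gt0_ltr_powR => //; rewrite nnegrE ?powR_ge0 ?ltW.
have [Dy|Dy] := eqVneq (energy hp hq D) +oo%E.
  rewrite Dy gt0_muley ?leey// lte_fin divr_gt0 ?powR_gt0//.
  by rewrite subr_gt0.
have [e eD] : exists e, energy hp hq D = e%:E.
  by exists (fine (energy hp hq D)); rewrite fineK// ge0_fin_numE ?energy_ge0// lt_neqAle Dy leey.
have e0 : 0 <= e by rewrite -lee_fin -eD energy_ge0.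
have mS l : measurable_fun (`[0%R, +oo[%classic : set R)
    (fun t : R => (w l)%:E * rearr D (t / 2 ^+ l)%R `^ q)%E.
  by apply: measurable_funeM; exact: measurable_rearr_scale.
have mSS : measurable_fun (`[0%R, +oo[%classic : set R) S.
  exact: ge0_emeasurable_sum.
apply: (@le_trans _ _ (\int[lam]_(t in `[0%R, +oo[) ((c `^ q)%:E * S t))%E).
  apply: ge0_le_integral => //.
  - exact: measurable_rearrX.
  - exact: measurable_funeM.
rewrite ge0_integralZl//; last by rewrite lee_fin powR_ge0.
rewrite EFinM -muleA lee_wpmul2l ?lee_fin ?powR_ge0// integral_nneseries//.
rewrite nneseries_esumT; last by move=> l; exact: integral_ge0.
(* The l-th term carries the factor 2^(l q/p) by dilation and the weight w l. *)
rewrite (_ : (\esum_(l in _) _)%E =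
    (\esum_(l in [set: nat]) (e * (2 `^ (q / p) / rho `^ q) ^+ l)%:E)%E).
  by rewrite esum_geometric// eD -EFinM mulrC.
apply: eq_esum => l _; rewrite ge0_integralZl//; last 2 first.
- exact: measurable_rearr_scale.
- by rewrite lee_fin ltW.
rewrite energy_dilation ?exprn_gt0// eD -!EFinM; congr EFin.
rewrite /w !powRX ?(ltW rho0)// expr_div_n; ring.
Qed.

(** Averaging is bounded because p > 1: there is room for a rho between
    2^(1/p), needed for energy_of_scales, and 2, needed for tail_sum_le. *)
Lemma bounded_op_avg (I J : choiceType) (a : I -> {posnum R}) (b : J -> {posnum R})
    (blk : J -> seq I) (idx : I -> option J) :
  (forall j, uniq (blk j)) -> (forall i j, (i \in blk j) = (idx i == Some j)) ->
  (forall j, (b j)%:num <= mass a blk j) -> bounded_op hp hq a b (avg a blk).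
Proof.
move=> blk_uniq blkE bm.
have p0 : 0 < p by exact: lt_trans hp.
have hr : 2 `^ p^-1 < 2 :> R.
  rewrite -[ltRHS]powRr1// /powR pnatr_eq0/= ltr_expR ltr_pM2r ?invf_lt1//.
  by rewrite ln_gt0// ltr1n.
have r1 : 1 <= 2 `^ p^-1 :> R.
  by rewrite -[leLHS](powRr0 2) ler_powR ?ler1n// invr_ge0 ltW.
pose rho : R := (2 `^ p^-1 + 2) / 2.
have hrho : 2 `^ p^-1 < rho by rewrite /rho; lra.
have rho1 : 1 < rho by exact: le_lt_trans hrho.
have rho2 : rho < 2 by rewrite /rho; lra.
have c0 : 0 < 1 + avg_cst rho by rewrite addr_gt0// avg_cst_gt0.
split; first exact: linear_avg.
exists ((1 + avg_cst rho) `^ q / (1 - 2 `^ (q / p) / rho `^ q)).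
  rewrite divr_gt0 ?powR_gt0// subr_gt0.
  rewrite ltr_pdivrMr ?powR_gt0 ?(lt_trans ltr01)// mul1r mulrC powRrM.
  by apply: gt0_ltr_powR => //; rewrite nnegrE ?powR_ge0 ?ltW ?(lt_trans ltr01).
move=> x; apply: energy_of_scales => //; first exact: wdistr_nonincreasing.
by move=> t k k0; exact: wdistr_avg_le.
Qed.

End averaging.

(** * Isomorphisms of weighted sequence spaces *)

Section seq_iso.
Context {R : realType} (p q : R) (hp : 1 < p) (hq : 1 <= q).
Implicit Types (I J K : choiceType).
Local Notation bounded_op := (bounded_op hp hq).

Definition seq_iso I J (a : I -> {posnum R}) (b : J -> {posnum R}) : Prop :=
  exists F G, [/\ bounded_op a b F, bounded_op b a G, cancel F G & cancel G F].

Lemma seq_iso_sym I J (a : I -> {posnum R}) (b : J -> {posnum R}) :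
  seq_iso a b -> seq_iso b a.
Proof. by move=> [F [G [bF bG FK GK]]]; exists G, F. Qed.

Lemma seq_iso_trans I J K (a : I -> {posnum R}) (b : J -> {posnum R})
    (c : K -> {posnum R}) : seq_iso a b -> seq_iso b c -> seq_iso a c.
Proof.
move=> [F [G [bF bG FK GK]]] [F' [G' [bF' bG' FK' GK']]].
exists (F' \o F), (G \o G'); split.
- exact: bounded_op_comp bF bF'.
- exact: bounded_op_comp bG' bG.
- exact: can_comp.
- exact: can_comp.
Qed.

Lemma seq_iso_relabel I J (a : I -> {posnum R}) (b : J -> {posnum R})
    (e : J -> I) (e' : I -> J) (c : R) : cancel e e' -> cancel e' e -> 0 < c ->
  (forall j, (b j)%:num <= c * (a (e j))%:num) ->
  (forall j, (a (e j))%:num <= c * (b j)%:num) -> seq_iso a b.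
Proof.
move=> eK e'K c0 bc ac; exists (fun x j => x (e j)), (fun y i => y (e' i)); split.
- exact: bounded_op_relabel (can_inj eK) c0 bc.
- apply: bounded_op_relabel (can_inj e'K) c0 _ => i.
  by have := ac (e' i); rewrite e'K.
- by move=> x; apply/funext => i; rewrite e'K.
- by move=> x; apply/funext => i; rewrite eK.
Qed.

Lemma bounded_op_inl I J (a : I -> {posnum R}) (b : J -> {posnum R}) :
  bounded_op (wsum a b) a (fun x i => x (inl i)).
Proof.
by apply: (bounded_op_relabel hp hq (c := 1)) => [i j []||i]//; rewrite mul1r.
Qed.

Lemma bounded_op_inr I J (a : I -> {posnum R}) (b : J -> {posnum R}) :
  bounded_op (wsum a b) b (fun x i => x (inr i)).
Proof.
by apply: (bounded_op_relabel hp hq (c := 1)) => [i j []||i]//; rewrite mul1r.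
Qed.

Lemma seq_iso_sumr I J K (a : I -> {posnum R}) (b : J -> {posnum R})
    (c : K -> {posnum R}) : seq_iso b c -> seq_iso (wsum a b) (wsum a c).
Proof.
move=> [F [G [bF bG FK GK]]].
have X (L M : choiceType) (b' : L -> {posnum R}) (c' : M -> {posnum R}) H : bounded_op b' c' H ->
    bounded_op (wsum a b') (wsum a c') (fun x k => match k with
      inl i => x (inl i) | inr l => H (fun j => x (inr j)) l end).
  move=> bH; exact: (bounded_op_pair (bounded_op_inl a b') (bounded_op_comp (bounded_op_inr a b') bH)).
exists (fun x k => match k with
      inl i => x (inl i) | inr l => F (fun j => x (inr j)) l end).
exists (fun x k => match k with
      inl i => x (inl i) | inr l => G (fun j => x (inr j)) l end).
split; [exact: X|exact: X|..].
- move=> x; apply/funext => -[i|j]//.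
  by rewrite -[RHS](congr1 (fun f => f j) (FK (fun j => x (inr j)))).
- move=> x; apply/funext => -[i|j]//.
  by rewrite -[RHS](congr1 (fun f => f j) (GK (fun j => x (inr j)))).
Qed.

(** If b is a retract of a (by S and P) and b is isomorphic to its own square,
    then a ~ b + Z ~ b + b + Z ~ a + b with Z the kernel of P. The complement
    Z is not a space of the same kind, so the composite isomorphism is written
    out: the coordinate P x is cut in two by psi, one half stays in a and the
    other half becomes the new summand. *)
Lemma seq_iso_retract I J (a : I -> {posnum R}) (b : J -> {posnum R})
    (S : (J -> R) -> (I -> R)) (P : (I -> R) -> (J -> R))
    (psi : J + J -> J) (psi' : J -> J + J) :
  bounded_op b a S -> bounded_op a b P -> cancel S P ->
  cancel psi psi' -> cancel psi' psi ->
  (forall u, b (psi u) = wsum b b u) -> seq_iso a (wsum a b).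
Proof.
move=> bS bP SK psiK psiK' bpsi.
have linS : linear_op S by case: bS.
have linP : linear_op P by case: bP.
have b1 : bounded_op b b (fun v u => v (psi (inl u))).
  apply: (bounded_op_relabel hp hq (c := 1)) => [i j /(can_inj psiK)[]||u]//.
  by rewrite mul1r bpsi.
have b2 : bounded_op b b (fun v u => v (psi (inr u))).
  apply: (bounded_op_relabel hp hq (c := 1)) => [i j /(can_inj psiK)[]||u]//.
  by rewrite mul1r bpsi.
have b3 : bounded_op (wsum b b) b (fun v u => v (psi' u)).
  apply: (bounded_op_relabel hp hq (c := 1)) => [||u]//; first exact: can_inj psiK'.
  by rewrite mul1r -bpsi psiK'.
have bE : bounded_op a a (fun x i => x i + - S (P x) i).
  exact: (bounded_opD (bounded_op_id hp hq a) (bounded_opN (bounded_op_comp bP bS))).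
exists (fun x k => match k with
  | inl i => (x i + - S (P x) i) + S (fun u => P x (psi (inl u))) i
  | inr u => P x (psi (inr u)) end).
pose mrg (y : I + J -> R) := fun u => match psi' u with
   inl v => P (fun i => y (inl i)) v | inr v => y (inr v) end.
exists (fun y i => (y (inl i) + - S (P (fun i => y (inl i))) i) + S (mrg y) i).
have PS x v : P (fun i => (x i + - S (P x) i) + S v i) = v.
  rewrite -[RHS]SK.
  have := linP (-1) (fun i => S (P x) i) (fun i => x i + S v i).
  rewrite SK => E.
  rewrite (_ : (fun i => _) = (fun i => -1 * S (P x) i + (x i + S v i))); last first.
    by apply/funext => i; ring.
  rewrite E; have := linP 1 x (fun i => S v i).
  rewrite (_ : (fun i => 1 * x i + S v i) = (fun i => x i + S v i)); last first.
    by apply/funext => i; rewrite mul1r.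
  by move=> ->; apply/funext => u; ring.
split.
- apply: (bounded_op_pair (F := fun x i => (x i + - S (P x) i) + S (fun u => P x (psi (inl u))) i)).
    exact: (bounded_opD bE (bounded_op_comp (bounded_op_comp bP b1) bS)).
  exact: (bounded_op_comp bP b2).
- apply: (bounded_opD (F := fun y i => y (inl i) + - S (P (fun i => y (inl i))) i)).
    exact: (bounded_op_comp (bounded_op_inl a b) bE).
  have := bounded_op_pair (bounded_op_comp (bounded_op_inl a b) bP) (bounded_op_inr a b).
  move=> /bounded_op_comp/(_ b3)/bounded_op_comp/(_ bS); exact.
- move=> x; apply/funext => i /=; rewrite PS.
  have -> : mrg (fun k => match k with
      | inl i => (x i + - S (P x) i) + S (fun u => P x (psi (inl u))) i
      | inr u => P x (psi (inr u)) end) = P x; last by ring.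
  apply/funext => u; rewrite /mrg PS -[in RHS](psiK' u).
  by case: (psi' u).
- move=> y; apply/funext => -[i|u] /=; rewrite PS; last by rewrite /mrg psiK.
  have -> : (fun u => mrg y (psi (inl u))) = P (fun i => y (inl i)).
    by apply/funext => u; rewrite /mrg psiK.
  ring.
Qed.

End seq_iso.

(** * Absorption into a universal space *)

Section absorption.
Context {R : realType} (p q : R) (hp : 1 < p) (hq : 1 <= q).
Context (K : countType) (w : K -> {posnum R}).
Implicit Types a : nat -> {posnum R}.

Definition small_mass a (v : R) (m n : nat) : R :=
  \sum_(m <= i < n | (a i)%:num <= v) (a i)%:num.

(** The atoms of size at most v have infinite total size: reaching v from every
    starting index m means reaching it infinitely often. *)
Definition divergent_below a (v : R) :=
  forall m, exists n, v <= small_mass a v m n.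

(** Atoms (k, (n, m)) of size w k: for each class k the index n provides one row
    for each atom to be absorbed, and m an infinite supply within the row. *)
Definition uweight (u : K * (nat * nat)) := w u.1.

(** Adding atoms of size at most v one at a time, the first total reaching v
    cannot exceed 2 v. *)
Lemma small_mass_window a v m : 0 < v -> divergent_below a v ->
  exists n, [/\ (m <= n)%N, v <= small_mass a v m n & small_mass a v m n <= 2 * v].
Proof.
move=> v0 /(_ m) ex; have [n vn min_n] := ex_minnP ex.
have : (m < n)%N.
  by rewrite ltnNge; apply/negP => nm; move: vn; rewrite /small_mass big_geq// leNgt v0.
case: n vn min_n => // n vn min_n; rewrite ltnS => mn; exists n.+1.
split=> //; first by rewrite leqW.
have : small_mass a v m n < v.
  by rewrite ltNge; apply/negP => /min_n; rewrite ltnn.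
rewrite /small_mass big_mkcond [in X in _ -> X]big_mkcond big_nat_recr//=.
by case: ifP => [an|_] H; lra.
Qed.

Lemma exists_index (I J : choiceType) (blk : J -> seq I) :
  (forall i j j', i \in blk j -> i \in blk j' -> j = j') ->
  exists idx : I -> option J, forall i j, (i \in blk j) = (idx i == Some j).
Proof.
move=> disj.
have /choice[idx idxP] : forall i, exists o : option J, forall j, (i \in blk j) = (o == Some j).
  move=> i; have [[j ij]|none] := pselect (exists j, i \in blk j).
    exists (Some j) => j'; rewrite (inj_eq Some_inj).
    apply/idP/eqP => [ij'|<-//]; exact: disj ij ij'.
  exists None => j; apply/negbTE/negP => ij; by apply: none; exists j.
by exists idx.
Qed.

(** The index set K * (nat * nat) is enumerated by pickle, and each index takes
    its block from the window that starts where the previous window ends. *)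
Lemma exists_blocks a : (forall k, divergent_below a (w k)%:num) ->
  exists (blk : K * (nat * nat) -> seq nat) idx,
  [/\ forall u, uniq (blk u), forall i u, (i \in blk u) = (idx i == Some u),
      forall u, (uweight u)%:num <= mass a blk u &
      forall u, mass a blk u <= 2 * (uweight u)%:num].
Proof.
move=> adiv.
have /choice[f fP] : forall km : K * nat, exists n, [/\ (km.2 <= n)%N,
    (w km.1)%:num <= small_mass a (w km.1)%:num km.2 n &
    small_mass a (w km.1)%:num km.2 n <= 2 * (w km.1)%:num].
  by move=> [k m]; exact: small_mass_window.
pose next (t m : nat) : nat :=
  if @unpickle (K * (nat * nat))%type t is Some u then f (u.1, m) else m.
(* st t is the first index not used by the blocks number 0, ..., t - 1. *)
pose st := fix st t := if t is t'.+1 then next t' (st t') else 0%N.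
have st_next t : (st t <= st t.+1)%N.
  by rewrite /= /next; case: unpickle => [u|]//; case: (fP (u.1, st t)).
have st_mono : {homo st : s t / (s <= t)%N}.
  exact: homo_leq leqnn leq_trans st_next.
pose blk (u : K * (nat * nat)) := [seq i <- index_iota (st (pickle u)) (st (pickle u).+1) |
  (a i)%:num <= (w u.1)%:num].
have massE u : mass a blk u =
    small_mass a (w u.1)%:num (st (pickle u)) (f (u.1, st (pickle u))).
  by rewrite /mass /blk big_filter /= /next pickleK.
have [idx idxP] : exists idx : nat -> option (K * (nat * nat))%type,
    forall i u, (i \in blk u) = (idx i == Some u).
  apply: exists_index => i u u'; rewrite !mem_filter !mem_index_iota.
  move=> /andP[_ /andP[ui iu]] /andP[_ /andP[u'i iu']].
  apply: (pcan_inj (@pickleK _)); apply/eqP; rewrite eqn_leq.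
  by apply/andP; split; rewrite leqNgt; apply/negP => /st_mono; lia.
exists blk, idx; split=> // u.
- by rewrite filter_uniq// iota_uniq.
- by rewrite massE; case: (fP (u.1, st (pickle u))).
- by rewrite massE; case: (fP (u.1, st (pickle u))).
Qed.

(** Every size occurs infinitely often: split the copies by parity. *)
Lemma universal_square : exists psi psi',
  [/\ cancel psi psi', cancel psi' psi &
      forall u, uweight (psi u) = wsum uweight uweight u].
Proof.
exists (fun s : K * (nat * nat) + K * (nat * nat) => match s with
  | inl u => (u.1, (u.2.1, (u.2.2).*2)) | inr u => (u.1, (u.2.1, (u.2.2).*2.+1)) end).
exists (fun u : K * (nat * nat) =>
  let v := (u.1, (u.2.1, u.2.2./2)) in if odd u.2.2 then inr v else inl v).
split.
- by move=> [[k [n m]]|[k [n m]]] /=; rewrite odd_double/= ?doubleK// uphalf_double.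
- move=> [k [n m]] /=; case: ifPn => om /=; congr (_, (_, _)).
    by rewrite -[RHS]odd_double_half om.
  by rewrite -[RHS]odd_double_half (negbTE om).
- by case.
Qed.

(** Hilbert's hotel: the atom n is comparable to the atoms of class k = kap n, so
    it takes the place (k, (n, 0)), whose occupant and its successors
    (k, (n, m)) each move up by one. *)
Lemma seq_iso_absorb a c : 0 < c ->
  (forall n, exists k, (a n)%:num <= c * (w k)%:num /\ (w k)%:num <= c * (a n)%:num) ->
  seq_iso hp hq (wsum a uweight) uweight.
Proof.
move=> c0 /choice[kap kapP].
pose h (u : K * (nat * nat)) : nat + K * (nat * nat) := let: (k, (n, m)) := u in
  if kap n == k then (if m is m'.+1 then inr (k, (n, m')) else inl n) else inr u.
pose h' (s : nat + K * (nat * nat)) : K * (nat * nat) := match s with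
  | inl n => (kap n, (n, 0%N))
  | inr (k, (n, m)) => if kap n == k then (k, (n, m.+1)) else (k, (n, m)) end.
pose C := Num.max 1 c.
have C0 : 0 < C by rewrite lt_max ltr01.
have C1 : 1 <= C by rewrite le_max lexx.
have cC x : 0 <= x -> c * x <= C * x by move=> x0; rewrite ler_wpM2r// le_max lexx orbT.
apply: (@seq_iso_relabel _ _ _ hp hq _ _ _ _ h h' C) => //.
- move=> [k [n m]]; rewrite /h; case: ifPn => [/eqP kn|nk] /=; last by rewrite (negbTE nk).
  by case: m => [|m] /=; rewrite ?kn ?eqxx.
- move=> [n|[k [n m]]] /=; first by rewrite eqxx.
  by rewrite /h; case: ifPn => nk; rewrite ?nk// (negbTE nk).
- move=> [k [n m]] /=; rewrite /uweight/=; case: ifPn => [/eqP kn|_] /=.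
    case: m => [|m] /=; last by rewrite ler_peMl.
    by rewrite -kn; apply: le_trans (cC _ _) => //; case: (kapP n).
  by rewrite ler_peMl.
- move=> [k [n m]] /=; rewrite /uweight/=; case: ifPn => [/eqP kn|_] /=.
    case: m => [|m] /=; last by rewrite ler_peMl.
    by rewrite -kn; apply: le_trans (cC _ _) => //; case: (kapP n).
  by rewrite ler_peMl.
Qed.

(** Blocks of atoms of a imitate all the atoms of the universal family, which
    makes the universal space a retract of the space of a; hence a absorbs
    uweight. Conversely uweight absorbs a. *)
Lemma seq_iso_universal a c : 0 < c ->
  (forall k, divergent_below a (w k)%:num) ->
  (forall n, exists k, (a n)%:num <= c * (w k)%:num /\ (w k)%:num <= c * (a n)%:num) ->
  seq_iso hp hq a uweight.
Proof.
move=> c0 adiv acomp; apply: seq_iso_trans (seq_iso_absorb c0 acomp).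
have [blk [idx [blk_uniq blkE wm mw]]] := exists_blocks adiv.
have [psi [psi' [psiK psiK' bpsi]]] := universal_square.
apply: (seq_iso_retract (S := step idx) (P := avg a blk) _ _ _ psiK psiK' bpsi).
- exact: bounded_op_step mw.
- exact: bounded_op_avg blk_uniq blkE wm.
- move=> y; apply: avg_step => // u; apply/eqP => u0.
  by have := wm u; rewrite /mass u0 big_nil leNgt/= => /negP; apply.
Qed.

End absorption.

(** * Coordinates on topological modules *)

Section coordinates.
Context {R : realType} (p q : R) (hp : 1 < p) (hq : 1 <= q).
Implicit Types (I J : choiceType) (V W : preTopologicalLmodType R).
Local Notation wenergy := (wenergy hp hq).

(** The module V is identified by coef with the space of sequences of finite
    energy, and its neighbourhoods are those of the energy balls. For q > p
    the balls need not be open, hence the formulation with neighbourhoods. *)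
Definition coordinates V I (a : I -> {posnum R}) : Prop := exists coef : V -> I -> R,
  [/\ forall k x y, coef (k *: x + y) = (fun i => k * coef x i + coef y i),
      injective coef,
      forall x, (wenergy a (coef x) < +oo)%E,
      forall z, (wenergy a z < +oo)%E -> exists x, coef x = z &
      forall x U, nbhs x U <-> exists2 e : R, 0 < e &
        forall y, (wenergy a (coef (y - x)%R) < e%:E)%E -> U y].

Lemma wenergy_lt_pMl I J (a : I -> {posnum R}) (b : J -> {posnum R}) x y (C e : R) :
  0 < C -> (wenergy b y <= C%:E * wenergy a x)%E -> (wenergy a x < (e / C)%:E)%E ->
  (wenergy b y < e%:E)%E.
Proof.
move=> C0 yx xe; apply: le_lt_trans yx _.
by rewrite -lte_pdivlMl// -EFinM mulrC.
Qed.

Lemma wenergyD_lt I (a : I -> {posnum R}) x y (e : R) :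
  (wenergy a x < (e / (2 * quasi_cst p q))%:E)%E ->
  (wenergy a y < (e / (2 * quasi_cst p q))%:E)%E ->
  (wenergy a (fun i => x i + y i)%R < e%:E)%E.
Proof.
move=> xe ye; apply: le_lt_trans (wenergyD _ _ _ _ _) _.
have K0 : 0 < quasi_cst p q by exact: quasi_cst_gt0.
rewrite -lte_pdivlMl//.
rewrite (_ : _ * _ = ((e / (2 * quasi_cst p q))%:E + (e / (2 * quasi_cst p q))%:E))%E.
  exact: (lteD xe ye).
by rewrite -EFinM -EFinD; congr EFin; field; rewrite gt_eqF.
Qed.

(** In coordinates, a bounded linear operator maps small balls into balls, so it
    is continuous. *)
Lemma isomorphic_of_seq_iso V W I J (a : I -> {posnum R}) (b : J -> {posnum R}) :
  coordinates V a -> coordinates W b -> seq_iso hp hq a b -> isomorphic V W.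
Proof.
move=> [cV [cV_lin cV_inj cV_fin cV_surj cV_nbhs]].
move=> [cW [cW_lin cW_inj cW_fin cW_surj cW_nbhs]].
move=> [F [G [[linF [C C0 FC]] [linG [C' C'0 GC]] FK GK]]].
have bnd_fin (k : R) (y z : \bar R) : 0 < k -> (y <= k%:E * z)%E -> (z < +oo)%E -> (y < +oo)%E.
  by move=> k0 yz zfin; apply: le_lt_trans yz _; rewrite lte_mul_pinfty ?lee_fin// ltW.
have /choice[f fE] : forall x, exists y, cW y = F (cV x).
  by move=> x; apply: cW_surj; exact: bnd_fin C0 (FC _) (cV_fin x).
have /choice[g gE] : forall y, exists x, cV x = G (cW y).
  by move=> y; apply: cV_surj; exact: bnd_fin C'0 (GC _) (cW_fin y).
have f_lin : linear f.
  by move=> k x y; apply: cW_inj; rewrite fE cV_lin linF cW_lin !fE.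
have g_lin : linear g.
  by move=> k x y; apply: cV_inj; rewrite gE cW_lin linG cV_lin !gE.
pose fL : {linear V -> W} := HB.pack f (GRing.isLinear.Build R V W *:%R f f_lin).
pose gL : {linear W -> V} := HB.pack g (GRing.isLinear.Build R W V *:%R g g_lin).
exists fL, g; split.
- by move=> x; apply: cV_inj; rewrite gE fE FK.
- by move=> y; apply: cW_inj; rewrite fE gE GK.
- move=> x U /cW_nbhs[e e0 eU]; apply/cV_nbhs; exists (e / C); first exact: divr_gt0.
  move=> y yx; apply: eU; rewrite -(raddfB fL) fE.
  exact: wenergy_lt_pMl C0 (FC _) yx.
- move=> x U /cV_nbhs[e e0 eU]; apply/cW_nbhs; exists (e / C'); first exact: divr_gt0.
  move=> y yx; apply: eU; rewrite -(raddfB gL) gE.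
  exact: wenergy_lt_pMl C'0 (GC _) yx.
Qed.

(** The energy of a pair is equivalent to the sum of the energies of its two
    components, by the quasi-triangle inequality in one direction and by the
    boundedness of the two projections in the other. *)
Lemma coordinates_prod V W I J (a : I -> {posnum R}) (b : J -> {posnum R}) :
  coordinates V a -> coordinates W b -> coordinates (V * W)%type (wsum a b).
Proof.
move=> [cV [cV_lin cV_inj cV_fin cV_surj cV_nbhs]].
move=> [cW [cW_lin cW_inj cW_fin cW_surj cW_nbhs]].
have [_ [C C0 lC]] := bounded_op_inl hp hq a b.
have [_ [C' C'0 rC]] := bounded_op_inr hp hq a b.
have K0 : 0 < quasi_cst p q by exact: quasi_cst_gt0.
have bnd_fin (k : R) (y z : \bar R) : 0 < k -> (y <= k%:E * z)%E -> (z < +oo)%E -> (y < +oo)%E.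
  by move=> k0 yz zfin; apply: le_lt_trans yz _; rewrite lte_mul_pinfty ?lee_fin// ltW.
pose c (x : V * W) (k : I + J) := match k with inl i => cV x.1 i | inr j => cW x.2 j end.
exists c; split.
- move=> k x y; apply/funext => -[i|j].
    exact: (congr1 (fun f => f i) (cV_lin k x.1 y.1)).
  exact: (congr1 (fun f => f j) (cW_lin k x.2 y.2)).
- move=> [x1 x2] [y1 y2] xy; congr (_, _).
    by apply: cV_inj; apply/funext => i; exact: (congr1 (fun f => f (inl i)) xy).
  by apply: cW_inj; apply/funext => i; exact: (congr1 (fun f => f (inr i)) xy).
- move=> [x1 x2]; apply: bnd_fin K0 (wenergy_sum _ _ _ _ _) _.
  by apply: lte_add_pinfty; [exact: cV_fin|exact: cW_fin].
- move=> z zfin.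
  have [x xz] := cV_surj _ (bnd_fin _ _ _ C0 (lC z) zfin).
  have [y yz] := cW_surj _ (bnd_fin _ _ _ C'0 (rC z) zfin).
  by exists (x, y); apply/funext => -[i|j]; rewrite /c/= ?xz ?yz.
- move=> [x1 x2] U; split.
    move=> [[U1 U2] /= [/cV_nbhs[e1 e10 H1] /cW_nbhs[e2 e20 H2]] HU].
    exists (Num.min (e1 / C) (e2 / C')); first by rewrite lt_min !divr_gt0.
    move=> [y1 y2]; rewrite EFin_min lt_min => /andP[E1 E2]; apply: HU; split => /=.
      apply: H1; exact: wenergy_lt_pMl C0 (lC _) E1.
    apply: H2; exact: wenergy_lt_pMl C'0 (rC _) E2.
  move=> [e e0 H]; pose e' := e / (2 * quasi_cst p q).
  have e'0 : 0 < e' by rewrite divr_gt0// mulr_gt0.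
  exists ([set y1 | wenergy a (cV (y1 - x1)%R) < e'%:E]%E,
          [set y2 | wenergy b (cW (y2 - x2)%R) < e'%:E]%E).
    by split => /=; [apply/cV_nbhs; exists e'|apply/cW_nbhs; exists e'].
  move=> [y1 y2] [/= E1 E2]; apply: H.
  apply: le_lt_trans (wenergy_sum _ _ _ _ _) _ => /=.
  rewrite -lte_pdivlMl//.
  rewrite (_ : _ * _ = (e'%:E + e'%:E))%E; first exact: (lteD E1 E2).
  by rewrite -EFinM -EFinD /e'; congr EFin; field; rewrite gt_eqF.
Qed.

End coordinates.

(** * Measurable functions on an atom *)

Section atom_constant.
Context d (T : measurableType d) (R : realType) (mu : {measure set T -> \bar R}).

(** For every r one of {f < r}, {r <= f} is null in the atom; the constant is the
    supremum of the r for which {f < r} is. *)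
Lemma atom_ae_constant (B : set T) (f : T -> R) : atom mu B ->
  measurable_fun setT f ->
  exists c, measurable (B `&` [set x | f x != c]) /\
    mu (B `&` [set x | f x != c]) = 0%E.
Proof.
move=> [mB B0 atomB] mf.
have mI (P : set R) : measurable P -> measurable (B `&` f @^-1` P).
  move=> mP; apply: measurableI => //; rewrite -[X in measurable X]setTI.
  exact: mf.
pose lo r := B `&` f @^-1` `]-oo, r[.
pose hi r := B `&` f @^-1` `[r, +oo[.
have mlo r : measurable (lo r) by apply: mI.
have mhi r : measurable (hi r) by apply: mI.
have lohi r : mu (lo r) = 0%E \/ mu (hi r) = 0%E.
  have [|] := atomB (lo r) (mlo r) (@subIsetl _ _ _); first by left.
  rewrite (_ : B `\` lo r = hi r); first by right.
  apply/seteqP; split => x /=; rewrite /lo /hi /= !in_itv/= andbT.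
    by move=> [Bx] H; split=> //; rewrite leNgt; apply/negP => fr; apply: H.
  by move=> [Bx rf]; split=> // -[_]; rewrite ltNge rf.
have not_both r : mu (lo r) = 0%E -> mu (hi r) = 0%E -> False.
  move=> l0 h0; suff : mu B = 0%E by move=> E; rewrite E ltxx in B0.
  rewrite (_ : B = lo r `|` hi r) ?measureU0//.
  rewrite /lo /hi -setIUr -preimage_setU; apply/seteqP; split=> [x Bx|x []//].
  by split=> //=; have [fr|fr] := ltP (f x) r; [left|right]; rewrite /= in_itv/= ?fr.
pose S := [set r | mu (lo r) = 0%E].
have null_bigcup (F : nat -> set T) : (forall n, measurable (F n)) ->
    (forall n, mu (F n) = 0%E) -> mu (\bigcup_n F n) = 0%E.
  move=> mF F0; apply/eqP; rewrite -measure_le0.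
  apply: le_trans (measure_sigma_subadditive mu mF (bigcup_measurable (fun n _ => mF n)) (@subset_refl _ _)) _.
  by rewrite eseries0.
have le_null (E F : set T) : measurable E -> measurable F -> E `<=` F -> mu F = 0%E -> mu E = 0%E.
  by move=> mE mF EF F0; apply/eqP; rewrite -measure_le0 -F0 le_measure ?inE.
have S_ub : exists n : nat, ~ S n%:R.
  apply/existsNP => H; have : mu B = 0%E; last by move=> E; rewrite E ltxx in B0.
  rewrite (_ : B = \bigcup_n lo n%:R); first exact: null_bigcup.
  apply/seteqP; split=> [x Bx|x [n _ []]//]; exists (Num.bound `|f x|) => //.
  split=> //=; rewrite in_itv/=.
  exact: le_lt_trans (ler_norm _) (archi_boundP (normr_ge0 _)).
have S_n0 : exists n : nat, S (- n%:R).
  apply: contrapT => /forallNP H; have : mu B = 0%E; last by move=> E; rewrite E ltxx in B0.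
  rewrite (_ : B = \bigcup_n hi (- n%:R)).
    by apply: null_bigcup => // n; case: (lohi (- n%:R)) => // /H.
  apply/seteqP; split=> [x Bx|x [n _ []]//]; exists (Num.bound `|f x|) => //.
  split=> //=; rewrite in_itv/= andbT lerNl.
  apply: le_trans (ler_norm _) _; rewrite normrN; exact: ltW (archi_boundP (normr_ge0 _)).
have S_down r s : r <= s -> S s -> S r.
  move=> rs; apply: le_null => // x []; rewrite /= !in_itv/= => Bx fr.
  by split=> //=; rewrite in_itv/= (lt_le_trans fr).
have hS : has_sup S.
  split; first by case: S_n0 => n Sn; exists (- n%:R).
  case: S_ub => n nSn; exists n%:R => r Sr; rewrite leNgt; apply/negP => nr.
  by apply: nSn; apply: S_down Sr; exact: ltW.
pose c := sup S.
have lo_c n : mu (lo (c - n.+1%:R^-1)) = 0%E.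
  have [s Ss] : exists2 s, S s & c - n.+1%:R^-1 < s by apply: sup_adherent.
  by move=> /ltW /S_down; apply.
have hi_c n : mu (hi (c + n.+1%:R^-1)) = 0%E.
  case: (lohi (c + n.+1%:R^-1)) => // Sc.
  have : c + n.+1%:R^-1 <= c by apply: ub_le_sup => //; case: hS.
  by rewrite gerDl leNgt invr_gt0 ltr0n.
exists c; have -> : B `&` [set x | f x != c] =
    (\bigcup_n lo (c - n.+1%:R^-1)) `|` (\bigcup_n hi (c + n.+1%:R^-1)).
  have inv_lt (e : R) : 0 < e -> exists n : nat, n.+1%:R^-1 < e.
    move=> e0; exists (Num.bound e^-1); rewrite invf_plt ?posrE//.
    by apply: lt_trans (archi_boundP _) _; rewrite ?invr_ge0 ?(ltW e0)// ltr_nat.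
  apply/seteqP; split=> x /=.
    move=> [Bx]; rewrite neq_lt => /orP[fc|fc]; [left|right].
      have [n ne] := inv_lt (c - f x) ltac:(by rewrite subr_gt0).
      by exists n => //; split=> //=; rewrite in_itv/= ltrBrDr -ltrBrDl.
    have [n ne] := inv_lt (f x - c) ltac:(by rewrite subr_gt0).
    by exists n => //; split=> //=; rewrite in_itv/= andbT -lerBrDl ltW.
  have i0 n : 0 < n.+1%:R^-1 :> R by rewrite invr_gt0 ltr0n.
  move=> [[n _ [Bx]]|[n _ [Bx]]]; rewrite /= in_itv/= ?andbT => fx; split=> //;
    apply/eqP => fc; move: fx (i0 n); rewrite fc; set e := _^-1; lra.
split; first by apply: measurableU; apply: bigcup_measurable.
rewrite measureU0 ?null_bigcup//; exact: bigcup_measurable.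
Qed.

End atom_constant.

(** * Coordinates on the Lorentz space of atoms *)

Section lorentz_coordinates.
Context {R : realType} (p q : R) (hp : 1 < p) (hq : 1 <= q).
Context d (T : measurableType d) (mu : {measure set T -> \bar R}).
Context (A : nat -> set T) (hA : purely_atomic mu A).
Context (a : nat -> {posnum R}) (aE : forall n, mu (A n) = (a n)%:num%:E).
Local Notation wenergy := (wenergy hp hq).
Local Notation L := (lorentz_space hp hq mu).

Let q_gt0 : 0 < q. Proof. exact: lt_le_trans hq. Qed.

Let mA n : measurable (A n). Proof. by case: hA => /(_ n)[]. Qed.

Let atomA n : atom mu (A n). Proof. by case: hA. Qed.

Let disjA n m x : A n x -> A m x -> n = m.
Proof. by move=> nx mx; case: hA => _ _ tA _; apply: tA => //; exists x. Qed.

Let rest := ~` \bigcup_n A n.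

Let mrest : measurable rest.
Proof. by apply: measurableC; exact: bigcup_measurable. Qed.

Let rest0 : mu rest = 0%E.
Proof. by case: hA => _ _ _; move/negligibleP; apply. Qed.

(** Points outside all the atoms get index 0; they form a null set. *)
Definition atom_index (x : T) : nat :=
  if pselect (exists n, A n x) is left h then projT1 (cid h) else 0%N.

Let atom_indexE n x : A n x -> atom_index x = n.
Proof.
move=> nx; rewrite /atom_index; case: pselect => [h|[]]; last by exists n.
by case: cid => m /= mx; apply: disjA mx nx.
Qed.

Definition step_fun (c : nat -> R) (x : T) : R := c (atom_index x).

Let measurable_step c : measurable_fun setT (step_fun c).
Proof.
move=> _ Y mY; rewrite setTI.
rewrite (_ : _ @^-1` Y = \bigcup_n (if `[< Y (c n) >] then A n else set0) `|`
    (if `[< Y (c 0%N) >] then rest else set0)).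
  apply: measurableU; last by case: ifP.
  by apply: bigcup_measurable => n _; case: ifP.
apply/seteqP; split=> x /=.
  have [[n nx]|none] := pselect (exists n, A n x).
    rewrite /step_fun (atom_indexE nx) => Yc; left; exists n => //.
    by case: asboolP.
  rewrite /step_fun /atom_index; case: pselect => // _ Yc; right.
  by case: asboolP => // _ [n _ nx]; apply: none; exists n.
case=> [[n _]|].
  by case: asboolP => // Yc nx; rewrite /step_fun (atom_indexE nx).
case: asboolP => // Yc nx; rewrite /step_fun /atom_index; case: pselect => // -[n xn].
by exfalso; apply: nx; exists n.
Qed.

HB.instance Definition _ c := isMeasurableFun.Build _ _ _ _ (step_fun c) (measurable_step c).

Lemma measure_step c s : mu [set x | (s < `|step_fun c x|)%R] = wdistr a c s.
Proof.
pose F n := if s < `|c n| then A n else set0.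
have mF n : measurable (F n) by rewrite /F; case: ifP.
have mS : measurable [set x | (s < `|step_fun c x|)%R].
  rewrite (_ : [set _ | _] = (Num.norm \o step_fun c) @^-1` `]s, +oo[).
    by rewrite -[X in measurable X]setTI; apply: measurableT_comp.
  by apply/seteqP; split => x /=; rewrite in_itv/= andbT.
have mFF : measurable (\bigcup_n F n) by exact: bigcup_measurable.
(* The null set rest is added on both sides, since the value there is c 0. *)
have E : \bigcup_n F n `|` rest = [set x | (s < `|step_fun c x|)%R] `|` rest.
  apply/seteqP; split=> x [xF|]; try by right.
    left; case: xF => n _; rewrite /F; case: ifP => // sc nx /=.
    by rewrite /step_fun (atom_indexE nx).
  have [[n nx]|none] := pselect (exists n, A n x); [left|right].
    by exists n => //; move: xF; rewrite /= /step_fun /F (atom_indexE nx) => ->.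
  by move=> [n _ nx]; apply: none; exists n.
rewrite -(measureU0 mS mrest rest0) -E measureU0//.
rewrite measure_bigcup//; last first.
  move=> n m _ _ [x []]; rewrite /F; case: ifP => // _ nx; case: ifP => // _.
  exact: disjA.
rewrite nneseries_esum//.
rewrite set_mem_set.
apply: eq_esum => n _; rewrite /F; case: ifP => _; last exact: measure0.
exact: aE.
Qed.

Lemma energy_step c : lorentz_norm hp hq mu (step_fun c) = (wenergy a c `^ q^-1)%E.
Proof.
rewrite /lorentz_norm -[wenergy a c]/(energy hp hq (wdistr a c)) /energy; congr (_ `^ _)%E.
apply: eq_integral => t _; congr (_ `^ _)%E.
by rewrite /rearrangement; under eq_set do rewrite measure_step.
Qed.

Definition represents (c : nat -> R) (f : T -> R) := f = step_fun c %[ae mu].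

Lemma represents_inj c c' f : represents c f -> represents c' f -> c = c'.
Proof.
move=> cf c'f; have cc' : step_fun c = step_fun c' %[ae mu].
  exact: ae_eq_trans (ae_eq_sym cf) c'f.
apply/funext => n; apply: contrapT => cn.
case: cc' => N [mN N0 HN].
have : (mu (A n) <= mu N)%E.
  apply: le_measure; rewrite ?inE//.
  move=> x nx; apply: HN => /=; rewrite /step_fun (atom_indexE nx) => H.
  by apply: cn; exact: H.
by rewrite N0 aE lee_fin leNgt => /negP; apply.
Qed.

Lemma exists_represents (f : {mfun T >-> R}) : exists c, represents c f.
Proof.
have /choice[c cP] := fun n => atom_ae_constant (atomA n) (measurable_funPT f).
exists c; pose N := \bigcup_n (A n `&` [set x | f x != c n]) `|` rest.
have mN : measurable (\bigcup_n (A n `&` [set x | f x != c n])).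
  by apply: bigcup_measurable => n _; case: (cP n).
exists N; split.
- exact: measurableU.
- rewrite measureU0//; apply/eqP; rewrite -measure_le0.
  apply: le_trans (measure_sigma_subadditive mu (fun n => (cP n).1) mN (@subset_refl _ _)) _.
  by rewrite eseries0// => n _ _; case: (cP n).
- move=> x /= fx; have [[n nx]|none] := pselect (exists n, A n x); last first.
    by right=> -[n _ nx]; apply: none; exists n.
  left; exists n => //; split=> //=; apply/eqP => fc; apply: fx => _.
  by rewrite /step_fun (atom_indexE nx).
Qed.

Let coef_ex : exists coef : L -> nat -> R,
  forall x : L, represents (coef x) (\val (repr x) : T -> R).
Proof.
have H (x : L) : exists c, represents c (\val (repr x) : T -> R).
  exact: exists_represents.
by have [coef coefP] := choice H; exists coef.
Qed.

Lemma lorentz_norm_represents c (f : {mfun T >-> R}) : represents c f ->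
  lorentz_norm hp hq mu f = (wenergy a c `^ q^-1)%E.
Proof.
move=> cf; rewrite -energy_step /lorentz_norm.
by rewrite (@rearrangement_ae_eq _ _ _ mu f (step_fun c : {mfun T >-> R}) cf).
Qed.

Lemma root_lt (E : \bar R) (e : R) : (0 <= E)%E -> 0 < e ->
  ((E `^ q^-1 < e%:E) = (E < (e `^ q)%:E))%E.
Proof.
have powK (x r : R) : 0 < r -> 0 <= x -> (x `^ r) `^ r^-1 = x.
  by move=> r0 x0; rewrite -powRrM mulfV ?gt_eqF// powRr1.
case: E => [r| |]//; last first.
  by move=> _ _; rewrite poweRyr ?invr_eq0 ?gt_eqF// !ltNge !leey.
rewrite poweR_EFin !lte_fin !lee_fin => r0 e0; apply/idP/idP => H.
  rewrite -[r](powK _ q^-1) ?invr_gt0// invrK.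
  by apply: gt0_ltr_powR => //; rewrite nnegrE ?powR_ge0 ?(ltW e0).
rewrite -[e](powK _ q) ?(ltW e0)//.
by apply: gt0_ltr_powR; rewrite ?invr_gt0// nnegrE ?powR_ge0.
Qed.

Let lin_represents k (x y : L) c c' : represents c (\val (repr x) : T -> R) ->
  represents c' (\val (repr y) : T -> R) ->
  represents (fun n => k * c n + c' n) (\val (repr (k *: x + y)) : T -> R).
Proof.
move=> cx c'y.
have -> : k *: x + y = lorentz_class (k *: repr x + repr y).
  rewrite -lorentz_class_add -lorentz_class_scale.
  by rewrite !lorentz_class_repr.
apply: ae_eq_trans (repr_lorentz_class _) _.
rewrite (_ : (\val (k *: repr x + repr y) : T -> R) =
  (fun t => k * (\val (repr x) : T -> R) t + (\val (repr y) : T -> R) t))//.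
by apply: filterS2 cx c'y => t cxt c'yt _ /=; rewrite (cxt I) (c'yt I).
Qed.

Lemma wenergy0 : wenergy a (fun=> 0) = 0%E.
Proof.
apply: integral0_eq => t; rewrite /= in_itv/= andbT => t0.
suff -> : rearr (wdistr a (fun=> 0)) t = 0%E by rewrite poweR0r// gt_eqF.
apply/eqP; rewrite eq_le rearr_ge0 andbT.
apply/lee_addgt0Pr => e e0; rewrite add0e; apply: rearr_le => //.
rewrite /wdistr esum1// => n _.
by rewrite normr0 ltNge ltW.
Qed.

(** A measurable function equals almost everywhere a unique step function on the
    atoms, with the same distribution function as its sequence of values, so
    the values serve as coordinates. By the quasi-triangle inequality the
    centres of the energy balls contained in a given ball form an open set, so
    energy balls are neighbourhoods. *)
Lemma coordinates_lorentz : coordinates hp hq (lorentz_space hp hq mu) a.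
Proof.
have [coef coefP] := coef_ex; exists coef.
have coef_lin k x y : coef (k *: x + y) = (fun n => k * coef x n + coef y n).
  exact: represents_inj (coefP _) (lin_represents k (coefP x) (coefP y)).
have coefB x y n : coef (x - y) n = coef x n - coef y n.
  have -> : x - y = (-1) *: y + x by rewrite scaleN1r addrC.
  by rewrite coef_lin; ring.
have qnormE x : lorentz_qnorm x = (wenergy a (coef x) `^ q^-1)%E.
  exact: lorentz_norm_represents.
have qnorm_lt x (e : R) : 0 < e ->
    (lorentz_qnorm x < e%:E)%E = (wenergy a (coef x) < (e `^ q)%:E)%E.
  by move=> e0; rewrite qnormE root_lt// wenergy_ge0.
split=> //.
- move=> x y xy; rewrite -[x]lorentz_class_repr -[y]lorentz_class_repr.
  apply/lorentz_classP; apply: ae_eq_trans (coefP x) _.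
  by rewrite xy; exact: ae_eq_sym (coefP y).
- move=> x; have := valP (repr x); rewrite inE => /=.
  rewrite /finite_lorentz_norm (lorentz_norm_represents (coefP x)).
  by apply: lty_poweRy; rewrite invr_eq0 gt_eqF.
- move=> z zfin.
  have zL : (step_fun z : {mfun T >-> R}) \in in_lorentz hp hq mu.
    by rewrite inE /= /finite_lorentz_norm energy_step poweR_lty.
  exists (lorentz_class (exist _ (step_fun z : {mfun T >-> R}) zL)).
  apply: represents_inj (coefP _) _.
  exact: repr_lorentz_class.
- move=> x U; split.
    rewrite nbhsE => -[V [oV Vx] VU].
    have [e e0 eV] := oV x Vx.
    exists (e `^ q); first exact: powR_gt0.
    by move=> y yx; apply/VU/eV; rewrite qnorm_lt.
  move=> [e e0 eU]; rewrite nbhsE.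
  (* V collects the centres of the energy balls contained in U. *)
pose V := [set y : L | exists2 r : R, 0 < r &
    forall z, (wenergy a (coef (z - y)%R) < r%:E)%E -> U z].
  have VU : V `<=` U.
    move=> y [r r0]; apply; rewrite subrr.
    rewrite (_ : coef 0 = fun=> 0) ?wenergy0 ?lte_fin//.
    by apply/funext => n; rewrite -(subrr y) coefB subrr.
  exists V => //; split; last by exists e.
  move=> y [r r0 rU]; pose r' := r / (2 * quasi_cst p q).
  have r'0 : 0 < r' by rewrite divr_gt0// mulr_gt0// quasi_cst_gt0.
  exists (r' `^ q^-1); first exact: powR_gt0.
  move=> z; rewrite qnorm_lt ?powR_gt0// -powRrM mulVf ?gt_eqF// powRr1 ?(ltW r'0)//.
  move=> zy; exists r' => // t tz; apply: rU.
  rewrite (_ : coef (t - y) = fun n => coef (t - z)%R n + coef (z - y)%R n)%R.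
    exact: wenergyD_lt tz zy.
  by apply/funext => n; rewrite !coefB; ring.
Qed.

End lorentz_coordinates.

(** * Classification of the sequences of sizes *)

Section atomic_measure.
Context {R : realType} (b : nat -> {posnum R}).

Definition atomic_measure : {measure set nat -> \bar R} :=
  mseries (fun n => mscale (NngNum (ge0 (b n))) (\d_n : {measure set nat -> \bar R})) 0.

Lemma atomic_measure1 n : atomic_measure [set n] = (b n)%:num%:E.
Proof.
rewrite /atomic_measure /= /mseries nneseries_esumT; last first.
  by move=> k; rewrite /mscale/= mule_ge0// lee_fin.
transitivity (\esum_(k in [set n]) (b n)%:num%:E)%E; last first.
  by rewrite esum_set1// lee_fin.
rewrite [RHS]esum_mkcond; apply: eq_esum => k _.
transitivity ((b k)%:num%:E * (k \in [set n])%:R%:E)%E; first by [].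
have [->|kn] := eqVneq k n.
  by rewrite mem_set// mule1.
by rewrite memNset ?mule0//=; exact/eqP.
Qed.

Lemma purely_atomic_atomic_measure : purely_atomic atomic_measure (fun n => [set n]).
Proof.
split.
- move=> n; split=> //; first by rewrite [X in (_ < X)%E]atomic_measure1 lte_fin.
  move=> B _ /subset_set1[->|->]; first by left; rewrite measure0.
  by right; rewrite setDv measure0.
- by move=> n; rewrite [X in (X < _)%E]atomic_measure1 ltry.
- by move=> i j _ _ [x [/= -> ->]].
- rewrite (_ : ~` _ = set0); first exact: negligible_set0.
  by apply/seteqP; split=> // n; apply; exists n.
Qed.

End atomic_measure.

Section partial_sums.
Context {R : realType}.
Implicit Types f : nat -> R.

Lemma sum_nonneg_mono f (m n : nat) : (forall i, 0 <= f i) -> (m <= n)%N ->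
  \sum_(0 <= i < m) f i <= \sum_(0 <= i < n) f i.
Proof.
by move=> f0 mn; rewrite (big_cat_nat (leq0n m) mn)//= lerDl sumr_ge0.
Qed.

Lemma partial_sum_cat f (v : R) (m : nat) :
  (forall B, exists n, B < \sum_(0 <= i < n) f i) -> (forall i, 0 <= f i) ->
  exists n, v <= \sum_(m <= i < n) f i.
Proof.
move=> unb f0; have [n vn] := unb (v + \sum_(0 <= i < m) f i).
exists (maxn m n); rewrite -(lerD2l (\sum_(0 <= i < m) f i)).
rewrite -big_cat_nat ?leq_maxl//= addrC.
by apply: le_trans (ltW vn) _; apply: sum_nonneg_mono => //; rewrite leq_maxr.
Qed.

Lemma nneseries_lty f B : (forall i, 0 <= f i) ->
  (forall n, \sum_(0 <= i < n) f i <= B) ->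
  (\sum_(0 <= n <oo) (f n)%:E < +oo)%E.
Proof.
move=> f0 fB; apply: le_lt_trans (ltry B).
apply: lime_le; first by apply: is_cvg_nneseries => n _ _; rewrite lee_fin.
by apply: nearW => n; rewrite sumEFin lee_fin.
Qed.

Lemma nneseries_eqy f : (forall i, 0 <= f i) ->
  (forall B, exists n, B < \sum_(0 <= i < n) f i) ->
  (\sum_(0 <= n <oo) (f n)%:E = +oo)%E.
Proof.
move=> f0 unb; apply/eqyP => B B0; have [n Bn] := unb B.
apply: le_trans (nneseries_lim_ge n _); last by move=> k _ _; rewrite lee_fin.
by rewrite sumEFin lee_fin ltW.
Qed.

Lemma unbounded_of_dvg f : (forall i, 0 <= f i) -> ~ cvgn (series f) ->
  forall B, exists n, B < \sum_(0 <= i < n) f i.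
Proof.
move=> f0 dvg B; apply: contrapT => /forallNP H; apply: dvg.
apply: nondecreasing_is_cvgn; first by move=> m n; exact: sum_nonneg_mono.
by exists B => _ [n _ <-] /=; rewrite leNgt; apply/negP; exact: H.
Qed.

Lemma cvg0_of_nneseries f : (forall i, 0 <= f i) ->
  (\sum_(0 <= n <oo) (f n)%:E < +oo)%E -> (f n)%:E @[n --> \oo] --> 0%E.
Proof.
move=> f0 sfin; apply: cvg_EFin; first exact: nearW.
apply: cvg_series_cvg_0; apply: contrapT => /(unbounded_of_dvg f0).
by move=> /(nneseries_eqy f0) E; rewrite E ltxx in sfin.
Qed.

End partial_sums.

Section classification.
Context {R : realType} (p q : R) (hp : 1 < p) (hq : 1 <= q).
Implicit Types a b : nat -> {posnum R}.
Local Notation seq_iso := (seq_iso hp hq).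
Local Notation sizes a := (fun n => (a n)%:num%:E).

Lemma divergent_below_of_unbounded a (v : R) :
  (forall B, exists n, B < small_mass a v 0 n) -> divergent_below a v.
Proof.
move=> unb m; have [B|i|n] := @partial_sum_cat R
    (fun i => if (a i)%:num <= v then (a i)%:num else 0) v m.
- by have [n Bn] := unb B; exists n; rewrite -big_mkcond.
- by case: ifP.
- by rewrite -big_mkcond => vn; exists n.
Qed.

Lemma bounded_of_not_divergent_below a (v : R) : ~ divergent_below a v ->
  exists B, forall n, small_mass a v 0 n <= B.
Proof.
move=> ndiv; apply: contrapT => /forallNP H; apply: ndiv.
apply: divergent_below_of_unbounded => B.
have /existsNP[n Bn] := H B; exists n; rewrite ltNge; exact/negP.
Qed.

(** Infinitely many atoms of size between d and v have infinite total size. *)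
Lemma divergent_below_infinite a (d v : R) : 0 < d -> (forall n, d <= (a n)%:num) ->
  (forall N, exists2 n, (N <= n)%N & (a n)%:num <= v) -> divergent_below a v.
Proof.
move=> d0 da inf; apply: divergent_below_of_unbounded => B.
have H (k : nat) : exists n, d * k%:R <= small_mass a v 0 n.
  elim: k => [|k [n IH]]; first by exists 0%N; rewrite mulr0 /small_mass big_geq.
  have [m nm mv] := inf n; exists m.+1.
  rewrite /small_mass big_mkcond big_nat_recr//= mv -big_mkcond/=.
  rewrite -natr1 mulrDr mulr1 lerD//; apply: le_trans IH _.
  rewrite /small_mass big_mkcond [leRHS]big_mkcond; apply: sum_nonneg_mono => // i.
  by case: ifP.
have [n Hn] := H (Num.bound (`|B| / d)); exists n; apply: lt_le_trans Hn.
apply: le_lt_trans (ler_norm B) _.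
have : 0 <= `|B| / d by rewrite divr_ge0// ltW.
by move=> /archi_boundP; rewrite ltr_pdivrMr// mulrC.
Qed.

Definition harmonic_size (n : nat) : {posnum R} := (n.+1%:R^-1)%:pos.

Lemma type_zeroI_harmonic : type_zeroI (sizes harmonic_size).
Proof.
split.
  by apply: cvg_EFin; [exact: nearW|exact: cvg_harmonic].
apply: (@nneseries_eqy R harmonic harmonic_ge0).
apply: unbounded_of_dvg; [exact: harmonic_ge0|exact: dvg_harmonic].
Qed.

Lemma divergent_below_harmonic v : 0 < v -> divergent_below harmonic_size v.
Proof.
move=> v0 m; have unb := unbounded_of_dvg harmonic_ge0 (@dvg_harmonic R).
pose m' := maxn m (Num.bound v^-1).
have [n vn] := partial_sum_cat v m' unb harmonic_ge0.
exists n; apply: le_trans vn _; have [nm'|m'n] := leqP n m'.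
  by rewrite big_geq// sumr_ge0.
have small i : (m' <= i)%N -> (harmonic_size i)%:num <= v.
  move=> mi; rewrite /= invf_ple ?posrE ?ltr0n//; apply: ltW.
  apply: lt_trans (archi_boundP _) _; first by rewrite invr_ge0 ltW.
  rewrite ltr_nat ltnS; apply: leq_trans mi; exact: leq_maxr.
rewrite /small_mass (big_cat_nat (leq_maxl m (Num.bound v^-1)) (ltnW m'n))/=.
rewrite ler_wpDl ?sumr_ge0//.
rewrite [leRHS]big_mkcond; apply: ler_sum_nat => i /andP[mi _].
by rewrite small.
Qed.

(** The universal family is taken to consist of the sizes of both sequences, so
    that comparability holds with constant 1; both sequences are isomorphic to
    it. *)
Lemma seq_iso_harmonic a : (forall v, 0 < v -> divergent_below a v) -> seq_iso a harmonic_size.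
Proof.
move=> adiv; pose w := wsum a harmonic_size.
have A : seq_iso a (uweight w).
  apply: (seq_iso_universal hp hq (c := 1)) => // [k|n]; first exact: adiv.
  by exists (inl n); rewrite !mul1r.
have H : seq_iso harmonic_size (uweight w).
  apply: (seq_iso_universal hp hq (c := 1)) => // [k|n]; first exact: divergent_below_harmonic.
  by exists (inr n); rewrite !mul1r.
exact: seq_iso_trans A (seq_iso_sym H).
Qed.

Lemma type_one_cst (M : {posnum R}) : type_one (fun=> M%:num%:E : \bar R).
Proof.
have [E1 E2] := cvg_limn_einf_sup (@cvg_cst _ M%:num%:E nat \oo _).
by split; rewrite ?E1 ?E2 ?lte_fin ?ltry.
Qed.

Lemma seq_iso_refl a : seq_iso a a.
Proof. by exists id, id; split=> //; exact: bounded_op_id. Qed.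

(** If the sizes do not tend to infinity, infinitely many are below some M, and
    blocks of these imitate any size above M. The universal family consists of
    M and of the sizes at least M; the sizes in [d, M] are comparable to
    M. The constant sequence M is isomorphic to the same universal space. *)
Lemma large_sizes a (d : R) : 0 < d -> (forall n, d <= (a n)%:num) ->
  exists2 b, seq_iso a b & type_one (sizes b) \/ type_infty (sizes b).
Proof.
move=> d0 da.
have [[M inf]|fin] := pselect (exists M : R,
    forall N, exists2 n, (N <= n)%N & (a n)%:num <= M); last first.
  exists a; [exact: seq_iso_refl|right].
  apply/cvgeyPge => v; have /existsNP[N HN] : ~ forall N, exists2 n, (N <= n)%N & (a n)%:num <= v.
    by move=> H; apply: fin; exists v.
  exists N => // n /= Nn; rewrite lee_fin leNgt; apply/negP => av.
  by apply: HN; exists n => //; exact: ltW.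
have M0 : 0 < M.
  by have [n _ aM] := inf 0%N; exact: lt_le_trans aM.
pose Mp := PosNum M0; exists (fun=> Mp); last by left; exact: type_one_cst.
pose w (k : option nat) : {posnum R} :=
  if k is Some n then (if M <= (a n)%:num then a n else Mp) else Mp.
pose c := Num.max 1 (M / d).
have c1 : 1 <= c by rewrite le_max lexx.
have c0 : 0 < c by exact: lt_le_trans c1.
have Mw k : M <= (w k)%:num by case: k => [n|]//=; case: ifP.
have A : seq_iso a (uweight w).
  apply: (seq_iso_universal hp hq c0) => [k|n].
    apply: (divergent_below_infinite d0 da) => N.
    by have [n Nn an] := inf N; exists n => //; exact: le_trans (Mw k).
  exists (Some n) => /=; case: ifPn => [Man|]; first by rewrite ler_peMl.
  rewrite -ltNge => aM; split=> /=; first by rewrite (le_trans (ltW aM))// ler_peMl// ltW.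
  apply: (@le_trans _ _ (M / d * (a n)%:num)).
    by rewrite mulrAC ler_pdivlMr// ler_wpM2l// ltW.
  by rewrite ler_wpM2r// le_max lexx orbT.
apply: seq_iso_trans A (seq_iso_sym _).
apply: (seq_iso_universal hp hq (c := 1)) => // [k|n].
  apply: (divergent_below_infinite M0) => // N.
  by exists N.
by exists None; rewrite mul1r.
Qed.

Lemma exists_enum (S : set nat) : (forall N, exists2 n, (N <= n)%N & S n) ->
  exists e : nat -> nat, [/\ injective e, forall n, S (e n) & forall m, S m -> exists n, e n = m].
Proof.
move=> inf; have infS : ~ finite_set S.
  move=> /finite_seqP[s Ss]; have [n Nn] := inf (\max_(i <- s) i).+1.
  rewrite Ss /= => ns; move: Nn; rewrite ltnNge => /negP; apply.
  by rewrite (big_rem n)//= leq_maxl.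
have : (S #= [set: nat])%card by exact: eq_card_nat.
rewrite card_eq_sym => /card_set_bijP[e [eS e_inj e_surj]].
exists e; split.
- by move=> m n /e_inj; apply; rewrite in_setT.
- by move=> n; exact: eS.
- by move=> m /e_surj[n _ <-]; exists n.
Qed.

Lemma seq_iso_split a (S : set nat) :
  (forall N, exists2 n, (N <= n)%N & S n) ->
  (forall N, exists2 n, (N <= n)%N & ~ S n) ->
  exists e1 e2 : nat -> nat, [/\ injective e1, forall n, S (e1 n), forall n, ~ S (e2 n) &
    seq_iso a (wsum (fun n => a (e1 n)) (fun n => a (e2 n)))].
Proof.
move=> /exists_enum[e1 [e1_inj Se1 e1_surj]] /exists_enum[e2 [e2_inj Se2 e2_surj]].
exists e1, e2; split=> //.
pose e (k : nat + nat) := match k with inl n => e1 n | inr n => e2 n end.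
have e_inj : injective e.
  move=> [m|m] [n|n] /=.
  - by move=> /e1_inj ->.
  - by move=> E; exfalso; apply: (Se2 n); rewrite -E.
  - by move=> E; exfalso; apply: (Se2 m); rewrite E.
  - by move=> /e2_inj ->.
have /choice[e' e'K] : forall i, exists k, e k = i.
  move=> i; have [/e1_surj[n <-]|/e2_surj[n <-]] := pselect (S i).
    by exists (inl n).
  by exists (inr n).
apply: (@seq_iso_relabel _ _ _ hp hq _ _ _ _ e e' 1) => //.
- by move=> k; apply: e_inj; rewrite e'K.
- by move=> [n|n]; rewrite mul1r.
- by move=> [n|n]; rewrite mul1r.
Qed.

Lemma iso_to_typeP (V : preTopologicalLmodType R) a b (P : (nat -> \bar R) -> Prop) :
  coordinates hp hq V a -> seq_iso a b -> P (sizes b) -> iso_to_type hp hq P V.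
Proof.
move=> Va ab Pb.
exists _, nat, (atomic_measure b), (fun n => [set n]); split.
- exact: purely_atomic_atomic_measure.
- rewrite (_ : _ \o _ = sizes b)//; apply/funext => n; exact: atomic_measure1.
- apply: isomorphic_of_seq_iso Va _ ab.
  exact: (coordinates_lorentz hp hq (purely_atomic_atomic_measure b) (atomic_measure1 b)).
Qed.

Lemma iso_to_sumP (V : preTopologicalLmodType R) a b1 b2 (P Q : (nat -> \bar R) -> Prop) :
  coordinates hp hq V a -> seq_iso a (wsum b1 b2) -> P (sizes b1) -> Q (sizes b2) ->
  iso_to_sum hp hq P Q V.
Proof.
move=> Va ab Pb1 Qb2.
have sE b : atomic_measure b \o (fun n => [set n]) = sizes b.
  apply/funext => n; exact: atomic_measure1.
exists _, nat, (atomic_measure b1), (fun n => [set n]).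
exists _, nat, (atomic_measure b2), (fun n => [set n]); split.
- by split; [exact: purely_atomic_atomic_measure|rewrite sE].
- by split; [exact: purely_atomic_atomic_measure|rewrite sE].
- apply: isomorphic_of_seq_iso Va _ ab; apply: coordinates_prod.
    exact: (coordinates_lorentz hp hq (purely_atomic_atomic_measure b1) (atomic_measure1 b1)).
  exact: (coordinates_lorentz hp hq (purely_atomic_atomic_measure b2) (atomic_measure1 b2)).
Qed.

Lemma type_zeroF_of_bounded b (B : R) :
  (forall n, \sum_(0 <= i < n) (b i)%:num <= B) -> type_zeroF (sizes b).
Proof.
move=> bB; have b0 i : 0 <= (b i)%:num by [].
have sfin := nneseries_lty b0 bB.
by split=> //; exact: cvg0_of_nneseries sfin.
Qed.

End classification.

Theorem corollary4p5 (R : realType) (p q : R) (hp : 1 < p) (hq : 1 <= q)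
    (hpq : p != q) (d : measure_display) (T : measurableType d)
    (mu : {measure set T -> \bar R}) (A : nat -> set T)
    (hA : purely_atomic mu A) :
  iso_to_type hp hq type_one (lorentz_space hp hq mu) \/
  iso_to_type hp hq type_infty (lorentz_space hp hq mu) \/
  iso_to_type hp hq type_zeroF (lorentz_space hp hq mu) \/
  iso_to_type hp hq type_zeroI (lorentz_space hp hq mu) \/
  iso_to_sum hp hq type_zeroF type_one (lorentz_space hp hq mu) \/
  iso_to_sum hp hq type_zeroF type_infty (lorentz_space hp hq mu).
Proof.
have /choice[a aE] : forall n, exists x : {posnum R}, mu (A n) = x%:num%:E.
  move=> n; case: hA => /(_ n)[_ An0 _] /(_ n) Any _ _.
  have x0 : 0 < fine (mu (A n)) by rewrite fine_gt0// An0.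
  by exists (PosNum x0); rewrite /= fineK// ge0_fin_numE.
have Va := coordinates_lorentz hp hq hA aE.
have [adiv|] := pselect (forall v, 0 < v -> divergent_below a v).
  right; right; right; left.
  exact: iso_to_typeP Va (seq_iso_harmonic hp hq adiv) type_zeroI_harmonic.
move=> /existsNP[v /not_implyP[v0 /bounded_of_not_divergent_below[B aB]]].
have [[N large]|small_inf] := pselect (exists N, forall n, (N <= n)%N -> v < (a n)%:num).
  have [d0 d0_gt0 d0a] : exists2 d0 : R, 0 < d0 & forall n, d0 <= (a n)%:num.
    have [e e0 ea] : exists2 e : R, 0 < e & forall n, (n < N)%N -> e <= (a n)%:num.
      elim: N {large} => [|N [e e0 ea]]; first by exists 1.
      exists (Num.min e (a N)%:num); first by rewrite lt_min e0/=.
      move=> n; rewrite ltnS leq_eqVlt => /predU1P[->|/ea H].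
        by rewrite ge_min lexx orbT.
      by rewrite ge_min H.
    exists (Num.min e v); first by rewrite lt_min e0.
    move=> n; rewrite ge_min; have [nN|Nn] := ltnP n N; first by rewrite ea.
    by rewrite (ltW (large n Nn)) orbT.
  have [b ab [b1|binf]] := large_sizes hp hq d0_gt0 d0a.
    by left; exact: iso_to_typeP Va ab b1.
  by right; left; exact: iso_to_typeP Va ab binf.
have {}small_inf N : exists2 n, (N <= n)%N & (a n)%:num <= v.
  apply: contrapT => H; apply: small_inf; exists N => n Nn.
  by rewrite ltNge; apply/negP => av; apply: H; exists n.
have [[N small]|large_inf] := pselect (exists N, forall n, (N <= n)%N -> (a n)%:num <= v).
  right; right; left; apply: iso_to_typeP Va (seq_iso_refl hp hq a) _.
  apply: (@type_zeroF_of_bounded _ _ (\sum_(0 <= i < N) (a i)%:num + B)) => n.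
  have H : \sum_(0 <= i < maxn N n) (a i)%:num <= \sum_(0 <= i < N) (a i)%:num + B.
    rewrite (big_cat_nat (leq0n N) (leq_maxl N n))//= lerD2l.
    apply: le_trans (aB (maxn N n)).
    rewrite /small_mass (big_cat_nat (leq0n N) (leq_maxl N n))//=.
    rewrite ler_wpDl ?sumr_ge0//.
    rewrite [leRHS]big_mkcond; apply: ler_sum_nat => i /andP[Ni _].
    by rewrite small.
  by apply: le_trans H; apply: sum_nonneg_mono => //; rewrite leq_maxr.
have {}large_inf N : exists2 n, (N <= n)%N & ~ [set n | (a n)%:num <= v] n.
  apply: contrapT => H; apply: large_inf; exists N => n Nn.
  by apply: contrapT => av; apply: H; exists n.
have [e1 [e2 [e1_inj e1S e2L iso]]] := seq_iso_split hp hq a small_inf large_inf.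
have e2v n : v <= (a (e2 n))%:num.
  by rewrite leNgt; apply/negP => /ltW; exact: e2L.
have e1_lty : (\sum_(0 <= n <oo) (a (e1 n))%:num%:E < +oo)%E.
  pose f i := if (a i)%:num <= v then (a i)%:num else 0.
  have f0 i : 0 <= f i by rewrite /f; case: ifP.
  have fB n : \sum_(0 <= i < n) f i <= B by rewrite -big_mkcond; exact: aB.
  apply: le_lt_trans (nneseries_lty f0 fB).
  rewrite !nneseries_esumT//.
  apply: le_trans (le_esum_inj e1_inj _); last by move=> n; rewrite lee_fin.
  by apply: le_esum => n _; rewrite /f e1S.
have F1 : type_zeroF (fun n => (a (e1 n))%:num%:E).
  by split=> //; exact: cvg0_of_nneseries e1_lty.
have [b ab bT] := large_sizes hp hq v0 e2v.
have iso' := seq_iso_trans iso (seq_iso_sumr _ ab).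
case: bT => bT; right; right; right; right.
  by left; exact: iso_to_sumP Va iso' F1 bT.
by right; exact: iso_to_sumP Va iso' F1 bT.
Qed.
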